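(* Let $\Omega$ be an infinite set. Then there exists a $0,1$-lattice embedding (a one-to-one lattice homomorphism preserving least and greatest elements) from $(\operatorname{Eq}\Omega)\amalg(\operatorname{Eq}\Omega)$ into $\operatorname{Eq}\Omega$.
   Context: $\operatorname{Eq}\Omega$ denotes the lattice of all equivalence relations on the set $\Omega$, ordered by inclusion. For lattices $L_1,L_2$, $L_1\amalg L_2$ denotes their coproduct (free product) in the variety of all lattices (with lattice homomorphisms). *)

(* Defs.v *)
From Stdlib Require Import Relations List.
Set Implicit Arguments.

(** Eq Omega: equivalence relations on Omega. Two elements are identified
    when they are the same relation extensionally ([same_eq]). *)
Definition EqRel (O : Type) := {R : relation O | equivalence O R}.
Definition rel_of {O : Type} (R : EqRel O) : relation O := proj1_sig R.
Definition same_eq {O : Type} (R S : EqRel O) : Prop :=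
  forall x y, rel_of R x y <-> rel_of S x y.

Lemma meet_equivalence (O : Type) (R S : EqRel O) :
  equivalence O (fun x y => rel_of R x y /\ rel_of S x y).
Proof.
  destruct R as [R [rR tR sR]], S as [S [rS tS sS]]; simpl.
  split.
  - intro x; split; auto.
  - intros x y z [] []; split; eauto.
  - intros x y []; split; auto.
Qed.

Lemma join_equivalence (O : Type) (R S : EqRel O) :
  equivalence O (clos_trans O (union O (rel_of R) (rel_of S))).
Proof.
  destruct R as [R [rR tR sR]], S as [S [rS tS sS]]; simpl.
  split.
  - intro x; apply t_step; left; apply rR.
  - intros x y z H1 H2; eapply t_trans; eauto.
  - intros x y H; induction H as [x y [H|H]| x y z _ IH1 _ IH2].
    + apply t_step; left; auto.
    + apply t_step; right; auto.
    + eapply t_trans; eauto.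
Qed.

Lemma top_equivalence (O : Type) : equivalence O (fun _ _ => True).
Proof. split; red; auto. Qed.

Lemma bot_equivalence (O : Type) : equivalence O (@eq O).
Proof. split; red; intros; subst; auto. Qed.

Definition eq_meet {O : Type} (R S : EqRel O) : EqRel O :=
  exist _ _ (meet_equivalence R S).
Definition eq_join {O : Type} (R S : EqRel O) : EqRel O :=
  exist _ _ (join_equivalence R S).
Definition eq_top (O : Type) : EqRel O := exist _ _ (top_equivalence O).
Definition eq_bot (O : Type) : EqRel O := exist _ _ (bot_equivalence O).

Definition eq_lattice_hom {O1 O2 : Type} (g : EqRel O1 -> EqRel O2) : Prop :=
  (forall R S, same_eq R S -> same_eq (g R) (g S)) /\
  (forall R S, same_eq (g (eq_meet R S)) (eq_meet (g R) (g S))) /\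
  (forall R S, same_eq (g (eq_join R S)) (eq_join (g R) (g S))).

Inductive lterm (X : Type) : Type :=
| LVar : X -> lterm X
| LMeet : lterm X -> lterm X -> lterm X
| LJoin : lterm X -> lterm X -> lterm X.
Arguments LVar {X} _.
Arguments LMeet {X} _ _.
Arguments LJoin {X} _ _.

(** The coproduct (free product) (Eq O) ⨿ (Eq O) in the variety of lattices,
    presented as lattice terms over the disjoint union of the two copies of
    Eq O, modulo the smallest congruence containing the lattice axioms and
    the operation tables (and equalities) of both factors. *)
Definition fpgen (O : Type) := (EqRel O + EqRel O)%type.

Inductive fp_equiv (O : Type) : lterm (fpgen O) -> lterm (fpgen O) -> Prop :=
| fp_refl t : fp_equiv t t
| fp_sym t s : fp_equiv t s -> fp_equiv s t
| fp_trans t s u : fp_equiv t s -> fp_equiv s u -> fp_equiv t u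
| fp_cong_meet t t' s s' :
    fp_equiv t t' -> fp_equiv s s' -> fp_equiv (LMeet t s) (LMeet t' s')
| fp_cong_join t t' s s' :
    fp_equiv t t' -> fp_equiv s s' -> fp_equiv (LJoin t s) (LJoin t' s')
| fp_meet_comm t s : fp_equiv (LMeet t s) (LMeet s t)
| fp_join_comm t s : fp_equiv (LJoin t s) (LJoin s t)
| fp_meet_assoc t s u : fp_equiv (LMeet t (LMeet s u)) (LMeet (LMeet t s) u)
| fp_join_assoc t s u : fp_equiv (LJoin t (LJoin s u)) (LJoin (LJoin t s) u)
| fp_absorb_mj t s : fp_equiv (LMeet t (LJoin t s)) t
| fp_absorb_jm t s : fp_equiv (LJoin t (LMeet t s)) t
| fp_same_l R S : same_eq R S -> fp_equiv (LVar (inl R)) (LVar (inl S))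
| fp_same_r R S : same_eq R S -> fp_equiv (LVar (inr R)) (LVar (inr S))
| fp_meet_l R S :
    fp_equiv (LVar (inl (eq_meet R S))) (LMeet (LVar (inl R)) (LVar (inl S)))
| fp_join_l R S :
    fp_equiv (LVar (inl (eq_join R S))) (LJoin (LVar (inl R)) (LVar (inl S)))
| fp_meet_r R S :
    fp_equiv (LVar (inr (eq_meet R S))) (LMeet (LVar (inr R)) (LVar (inr S)))
| fp_join_r R S :
    fp_equiv (LVar (inr (eq_join R S))) (LJoin (LVar (inr R)) (LVar (inr S))).

(** The map on the coproduct induced by two lattice homomorphisms g1, g2
    (the copairing [g1, g2]), computed on representing terms. *)
Fixpoint fp_eval {O O' : Type} (g1 g2 : EqRel O -> EqRel O')
  (t : lterm (fpgen O)) : EqRel O' :=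
  match t with
  | LVar (inl R) => g1 R
  | LVar (inr R) => g2 R
  | LMeet t s => eq_meet (fp_eval g1 g2 t) (fp_eval g1 g2 s)
  | LJoin t s => eq_join (fp_eval g1 g2 t) (fp_eval g1 g2 s)
  end.

Definition fp_top (O : Type) : lterm (fpgen O) :=
  LJoin (LVar (inl (eq_top O))) (LVar (inr (eq_top O))).
Definition fp_bot (O : Type) : lterm (fpgen O) :=
  LMeet (LVar (inl (eq_bot O))) (LVar (inr (eq_bot O))).

Definition infinite_type (O : Type) : Prop :=
  forall l : list O, exists x : O, ~ In x l.

(* Main.v *)
From mathcomp Require Import all_boot boolp classical_sets functions cardinality.
Require Import Defs.
From Stdlib Require Import Relations List.
Set Implicit Arguments.
Unset Strict Implicit.
Unset Printing Implicit Defensive.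

(** Write [L] for the coproduct.  Terms built from principal equivalences of the
    two copies of [Eq O] are compact in [L] and every element of [L] is
    determined by the compact elements below it; both facts are read off the
    solution of the word problem for free products.  As in the
    Whitman-Jonsson representation theorem, a set of points with distances in
    the compact elements is closed freely under inserting, whenever
    [d x y <= a \/ b], a path [x -a- _ -b- _ -a- _ -b- y].  Sending an element
    [t] of [L] to the relation [d x y <= t] is then an embedding of [L] into the
    equivalences on the points: joins are preserved because distances are
    compact, and injectivity holds because every compact element is a distance.
    The points are finite trees over [O], so for infinite [O], after identifying
    points at least distance, there are exactly as many of them as elements of
    [O]. *)

(** * Squares of infinite sets *)

(** Choice gives an element outside each list; iterating it, each new value avoids the list [l n] of
    all earlier ones. *)
Lemma infinite_nat_injection (O : Type) :
  infinite_type O -> exists e : nat -> O, injective e.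
Proof.
move=> /choice[fresh freshP].
pose l := fix l n := if n is n'.+1 then fresh (l n') :: l n' else nil.
have inl m n : m < n -> In (fresh (l m)) (l n).
  elim: n => // n IH; rewrite ltnS leq_eqVlt => /orP[/eqP->|/IH]; first by left.
  by right.
exists (fun n => fresh (l n)) => m n emn.
case: (ltngtP m n) => // /inl; first by rewrite emn => /freshP.
by rewrite -emn => /freshP.
Qed.

(** Zorn's lemma on graphs of partial injections: if a maximal one missed a point on both sides,
    that pair of points could be added to it. *)
Lemma injection_total (X Y : Type) :
  (exists f : X -> Y, injective f) \/ (exists g : Y -> X, injective g).
Proof.
pose P (G : set (X * Y)) :=
  (forall x y y', G (x, y) -> G (x, y') -> y = y') /\
  (forall x x' y, G (x, y) -> G (x', y) -> x = x').
have [F FP Ftot|G [[Gfun Ginj] Gmax]] := @Zorn_bigcup _ P.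
  split=> [x y y' [G FG Gxy] [G' FG' Gxy']|x x' y [G FG Gxy] [G' FG' Gxy']].
    by have [GG|GG] := Ftot _ _ FG FG';
      [apply: (proj1 (FP _ FG')) (GG _ Gxy) Gxy'
      |apply: (proj1 (FP _ FG)) Gxy (GG _ Gxy')].
  by have [GG|GG] := Ftot _ _ FG FG';
    [apply: (proj2 (FP _ FG')) (GG _ Gxy) Gxy'
    |apply: (proj2 (FP _ FG)) Gxy (GG _ Gxy')].
have [/choice[f Gf]|noX] := pselect (forall x, exists y, G (x, y)).
  by left; exists f => x x' fx; apply: (Ginj _ _ (f x)); rewrite // fx.
have [/choice[g Gg]|noY] := pselect (forall y, exists x, G (x, y)).
  by right; exists g => y y' gy; apply: (Gfun (g y)); rewrite // gy.
have [x0 Nx0] := (existsNP _).2 noX; have [y0 Ny0] := (existsNP _).2 noY.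
exfalso; apply: (Gmax (fun p => G p \/ p = (x0, y0))).
  split=> [p Gp|sub]; first by left.
  by apply: Nx0; exists y0; apply: sub; right.
split.
  move=> x y y' [Gxy|[ex ey]] [Gxy'|[ex' ey']].
  - exact: Gfun Gxy Gxy'.
  - by case: Nx0; exists y; rewrite -ex'.
  - by case: Nx0; exists y'; rewrite -ex.
  - by rewrite ey ey'.
move=> x x' y [Gxy|[ex ey]] [Gxy'|[ex' ey']].
- exact: Ginj Gxy Gxy'.
- by case: Ny0; exists x; rewrite -ey'.
- by case: Ny0; exists x'; rewrite -ey.
- by rewrite ex ex'.
Qed.

Section Squaring.
Variable O : Type.

(** The carrier is read off the diagonal, so the graph alone determines it and Zorn's lemma can be
    applied to graphs ordered by inclusion. *)
Definition field (G : set (O * O * O)) (x : O) := exists z, G (x, x, z).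

(* [G] is the graph of an injection of [A * A] into [A], where [A = field G]. *)
Definition square_injection (G : set (O * O * O)) :=
  [/\ forall x y z z', G (x, y, z) -> G (x, y, z') -> z = z',
      forall x y x' y' z, G (x, y, z) -> G (x', y', z) -> x = x' /\ y = y',
      forall x y, field G x -> field G y -> exists z, G (x, y, z)
    & forall x y z, G (x, y, z) -> [/\ field G x, field G y & field G z]].

Lemma field_sub (G G' : set (O * O * O)) x :
  (G `<=` G')%classic -> field G x -> field G' x.
Proof. by move=> GG' [z /GG']; exists z. Qed.

(** Each clause concerns at most two triples at a time, and in a chain any two triples lie in a
    common member. *)
Lemma square_injection_bigcup (F : set (set (O * O * O))) :
  (F `<=` square_injection)%classic -> total_on F subset ->
  square_injection (\bigcup_(G in F) G)%classic.
Proof.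
move=> FP Ftot; set U := (\bigcup_(G in F) G)%classic.
have sub G : F G -> (G `<=` U)%classic by move=> FG p Gp; exists G.
have two p q : U p -> U q -> exists G, [/\ F G, G p & G q].
  move=> [G FG Gp] [G' FG' Gq].
  have [GG|GG] := Ftot _ _ FG FG'; first by exists G'; split=> //; apply: GG.
  by exists G; split=> //; apply: GG.
split.
- by move=> x y z z' /two/[apply] -[G [/FP[+ _ _ _]]]; apply.
- by move=> x y x' y' z /two/[apply] -[G [/FP[_ + _ _]]]; apply.
- move=> x y [z Uxz] [z' /(two _ _ Uxz)[G [FG Gx Gy]]].
  have [||w Gw] := (let: And4 _ _ tot _ := FP _ FG in tot) x y.
  + by exists z.
  + by exists z'.
  by exists w, G.
- move=> x y z [G FG Gxyz].
  have [fx fy fz] := (let: And4 _ _ _ cl := FP _ FG in cl) _ _ _ Gxyz.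
  by split; apply: field_sub (sub _ FG) _.
Qed.

(* [h] maps [A = field G] onto a disjoint copy [A']; the pairs of [A + A'] outside
   [A * A] are sent into [A'], after coding in [A] the side of each component. *)
Lemma square_injection_extend (G : set (O * O * O)) (e : nat -> O)
    (h : {x | field G x} -> {x | ~ field G x}) :
  square_injection G -> injective e -> (forall n, field G (e n)) ->
  injective h -> exists G', (G `<` G')%classic /\ square_injection G'.
Proof.
move=> [Gfun Ginj Gtot Gcl] einj fe hinj.
(* Four distinct elements of [A] code the sides of the two components. *)
pose c (b b' : bool) := e (b + b'.*2)%N.
have cinj b1 b1' b2 b2' : c b1 b1' = c b2 b2' -> b1 = b2 /\ b1' = b2'.
  by move/einj; move: b1 b1' b2 b2' => [] [] [] [].
(* [h0] is [h] without the subset types, with the default value [x] outside [A]. *)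
have /choice[h0 h0P] (x : O) : exists y, forall fx : field G x,
    y = sval (h (exist _ x fx)).
  have [fx|nfx] := pselect (field G x); last by exists x.
  by exists (sval (h (exist _ x fx))) => fx'; rewrite (Prop_irrelevance fx fx').
have h0N x : field G x -> ~ field G (h0 x).
  by move=> fx; rewrite (h0P _ fx); case: (h _).
have h0inj x y : field G x -> field G y -> h0 x = h0 y -> x = y.
  move=> fx fy; rewrite (h0P _ fx) (h0P _ fy) => /eq_sig_hprop E.
  by have [] : exist (field G) x fx = exist _ y fy
    by apply: hinj; apply: E => ? ? ?; apply: Prop_irrelevance.
pose copy (b : bool) x := if b then h0 x else x.
have copyinj b b' x x' : field G x -> field G x' ->
    copy b x = copy b' x' -> b = b' /\ x = x'.
  move: b b' => [] [] fx fx' //=; first by move/h0inj; split=> //; auto.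
    by move=> E; case: (h0N _ fx); rewrite E.
  by move=> E; case: (h0N _ fx'); rewrite -E.
pose G' (p : O * O * O) := G p \/ exists b b' x x' w z,
  [/\ b || b', field G x & field G x'] /\
  [/\ G (x, x', w), G (c b b', w, z) & p = (copy b x, copy b' x', h0 z)].
have inF x y z : G (x, y, z) -> field G z by move/Gcl=> [].
(* Old triples become the case where both sides are [false], with [v = w] as a dummy code; every
   clause is then checked uniformly. *)
have key x y z : G' (x, y, z) <-> exists b b' u u' w v,
    [/\ field G u, field G u', G (u, u', w) & x = copy b u /\ y = copy b' u'] /\
    (if b || b' then G (c b b', w, v) /\ z = h0 v else z = w /\ v = w).
  split=> [[Gxyz|]|].
  - have [fx fy fz] := Gcl _ _ _ Gxyz.
    by exists false, false, x, y, z, z.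
  - move=> [b [b' [u [u' [w [v [[bb fu fu'] [Gw Gv [-> -> ->]]]]]]]]].
    by exists b, b', u, u', w, v; rewrite bb.
  - move=> [b [b' [u [u' [w [v [[fu fu' Gw [-> ->]]]]]]]]].
    case: ifP => [bb [Gv ->]|bb [-> _]].
      by right; exists b, b', u, u', w, v.
    by left; move: b b' bb => [] [].
have fG' x : field G' x <-> exists b u, field G u /\ x = copy b u.
  split=> [[z /key[b [b' [u [u' [w [v [[fu _ _ [-> _]]]]]]]]]]|[b [u [fu ->]]]].
    by exists b, u.
  have [w Gw] := Gtot _ _ fu fu.
  have [v Gv] := Gtot _ _ (fe (b + b.*2)%N) (inF _ _ _ Gw).
  exists (if b then h0 v else w); apply/key.
  exists b, b, u, u, w, (if b then v else w); split=> //.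
  by case: (b) Gv => Gv.
exists G'; split; first split.
- by move=> p Gp; left.
- move=> sub; have fG'x : field G' (h0 (e 0)) by apply/fG'; exists true, (e 0).
  exact: (h0N _ (fe 0)) (field_sub sub fG'x).
- split.
  + move=> x y z z' /key[b [b' [u [u' [w [v [[fu fu' Gw [-> ->]] Z]]]]]]].
    move=> /key[d [d' [t [t' [r [s [[ft ft' Gr [E E']] Z']]]]]]].
    have [? ?] := copyinj _ _ _ _ fu ft E; have [? ?] := copyinj _ _ _ _ fu' ft' E'.
    subst d d' t t'; have ? := Gfun _ _ _ _ Gw Gr; subst r.
    move: Z Z'; case: ifP => _; last by move=> [-> _] [-> _].
    by move=> [A ->] [B ->]; rewrite (Gfun _ _ _ _ A B).
  + move=> x y x' y' z /key[b [b' [u [u' [w [v [[fu fu' Gw [-> ->]] Z]]]]]]].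
    move=> /key[d [d' [t [t' [r [s [[ft ft' Gr [-> ->]] Z']]]]]]].
    suff [-> -> ?] : [/\ b = d, b' = d' & w = r].
      by subst r; have [-> ->] := Ginj _ _ _ _ _ Gw Gr.
    move: Z Z'; case: ifP => bb; case: ifP => dd.
    * move=> [Gv ->] [Gs E]; have ? := h0inj _ _ (inF _ _ _ Gv) (inF _ _ _ Gs) E.
      by subst s; have [/cinj[-> ->] ->] := Ginj _ _ _ _ _ Gv Gs.
    * move=> [Gv ->] [E _]; case: (h0N _ (inF _ _ _ Gv)); rewrite E.
      exact: inF Gr.
    * move=> [-> _] [Gs E]; case: (h0N _ (inF _ _ _ Gs)); rewrite -E.
      exact: inF Gw.
    * by move=> [-> _] [-> _]; move: b b' d d' bb dd => [] [] [] [].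
  + move=> x y /fG'[b [u [fu ->]]] /fG'[b' [u' [fu' ->]]].
    have [w Gw] := Gtot _ _ fu fu'.
    have [v Gv] := Gtot _ _ (fe (b + b'.*2)%N) (inF _ _ _ Gw).
    exists (if b || b' then h0 v else w); apply/key.
    exists b, b', u, u', w, (if b || b' then v else w); split=> //.
    by case: (b || b').
  + move=> x y z /key[b [b' [u [u' [w [v [[fu fu' Gw [-> ->]] Z]]]]]]].
    split; apply/fG'; [by exists b, u|by exists b', u'|].
    move: Z; case: ifP => _ [A]; last by exists false, w; split=> //; exact: inF Gw.
    by move=> ->; exists true, v; split=> //; exact: inF A.
Qed.

(** Zorn's lemma applied to square injections that extend one on a countable subset. For a maximal
    carrier [A] the complement must inject into [A], whence [O] embeds into [A * A], hence into [A],
    and the square of [A] is already embedded in [A]. *)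
Lemma infinite_square_injection :
  infinite_type O -> exists f : O * O -> O, injective f.
Proof.
move=> /infinite_nat_injection[e einj].
pose G0 : set (O * O * O) := fun p =>
  exists m n, p = (e m, e n, e (pickle (m, n))).
have fG0 x : field G0 x <-> exists n, x = e n.
  by split=> [[z [m [n [-> _ _]]]]|[n ->]]; [exists m|exists (e (pickle (n, n))), n, n].
have G0P : square_injection G0.
  split.
  - move=> x y z z' [m [n [-> -> ->]]] [m' [n' []]].
    by move=> /einj<- /einj<- ->.
  - move=> x y x' y' z [m [n [-> -> ->]]] [m' [n' [-> ->]]].
    by move=> /einj/(pcan_inj pickleK)[-> ->].
  - by move=> x y /fG0[m ->] /fG0[n ->]; exists (e (pickle (m, n))), m, n.
  - by move=> x y z [m [n [-> -> ->]]]; split; apply/fG0; eexists.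
(* Adjoining [G0] inside the predicate makes the union of the empty chain admissible and keeps the
   countable part in the maximal element. *)
have [F FP Ftot|H [HP Hmax]] :=
    @Zorn_bigcup _ (fun H => square_injection (H `|` G0)%classic).
  have [F0|/existsNP[H0 /contrapT FH0]] := pselect (forall H, ~ F H).
    suff -> : (\bigcup_(X in F) X `|` G0)%classic = G0 by [].
    by apply/seteqP; split=> [p [[H /F0]|]|p] //; right.
  have -> : (\bigcup_(X in F) X `|` G0 =
      \bigcup_(X in [set (Y `|` G0) | Y in F]) X)%classic.
    apply/seteqP; split=> p.
      case=> [[H FH Hp]|G0p]; first by exists (H `|` G0)%classic; [exists H|left].
      by exists (H0 `|` G0)%classic; [exists H0|right].
    by case=> _ [H FH <-] [Hp|]; [left; exists H|right].
  apply: square_injection_bigcup; first by move=> _ [H FH <-]; apply: FP.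
  move=> _ _ [H FH <-] [H' FH' <-].
  by have [HH|HH] := Ftot _ _ FH FH'; [left|right]; apply: setSU.
set G := (H `|` G0)%classic in HP.
have fe n : field G (e n).
  by exists (e (pickle (n, n))); right; exists n, n.
case: (HP) => Gfun Ginj Gtot Gcl.
(* An injection of [A] into its complement contradicts maximality through the extension lemma. *)
have [[h hinj]|[g ginj]] :=
    injection_total {x | field G x} {x | ~ field G x}.
  have [G' [GG' G'P]] := square_injection_extend HP einj fe hinj.
  have G0G' : (G0 `<=` G')%classic.
    by move=> p G0p; case: GG' => + _; apply; right.
  exfalso; apply: (Hmax G').
    case: GG' => GG' GN; split=> [p Hp|G'H]; first by apply: GG'; left.
    by apply: GN => p /G'H; left.
  by rewrite (setUidPl _ _).2.
(* [r] codes [x] by an element of [A] and a mark: [e 0] for [x] in [A] itself, [e 1] for [x] moved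
   into [A] by [g]. *)
have /choice[r rP] (x : O) : exists y, field G y.1 /\
    exists b, y.2 = e b /\
    (if b is 0 then y.1 = x
     else exists nx : ~ field G x, y.1 = sval (g (exist _ x nx))).
  have [fx|nx] := pselect (field G x); first by exists (x, e 0); split=> //; exists 0.
  exists (sval (g (exist _ x nx)), e 1); split; first by case: (g _).
  by exists 1; split=> //; exists nx.
have rinj x y : r x = r y -> x = y.
  move=> E; have [_ [b [eb Hb]]] := rP x; have [_ [d [ed Hd]]] := rP y.
  move: eb Hb ed Hd; rewrite E => -> + /einj ?; subst d.
  case: b => [-> //|b [nx ->] [ny]] /eq_sig_hprop E'.
  have /ginj[] : g (exist _ x nx) = g (exist _ y ny)
    by apply: E' => ? ? ?; apply: Prop_irrelevance.
  by [].
have re x : field G (r x).2 by have [_ [b [-> _]]] := rP x; exact: fe.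
have /choice[s sP] (x : O) : exists z, G (r x, z).
  by have [fx _] := rP x; move: (re x) fx; case: (r x) => a b fb fa; exact: Gtot.
have sinj x y : s x = s y -> x = y.
  move=> E; apply: rinj; have := sP x; have := sP y; rewrite -E.
  case: (r x) (r y) => [a b] [a' b'] Gx Gy.
  by have [-> ->] := Ginj _ _ _ _ _ Gx Gy.
have /choice[f fP] (p : O * O) : exists z, G (s p.1, s p.2, z).
  apply: Gtot; have := sP p.1; have := sP p.2;
    case: (r p.1) (r p.2) => a b [a' b'] /Gcl[_ _ ?] /Gcl[_ _ ?] //.
exists f => -[x y] [x' y'] E; have := fP (x, y); have := fP (x', y').
rewrite -E => Gx Gy.
by have [/sinj /= -> /sinj /= ->] := Ginj _ _ _ _ _ Gx Gy.
Qed.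

End Squaring.

(** * The word problem in the free product *)

Section FreeProductOrder.
Variable O : Type.
Implicit Types (R S Q : EqRel O) (t s u : lterm (fpgen O)) (b : bool).

Lemma rel_refl R x : rel_of R x x.
Proof. by case: R => R [rR tR sR]; apply: rR. Qed.

Lemma rel_sym R x y : rel_of R x y -> rel_of R y x.
Proof. by case: R => R [rR tR sR]; apply: sR. Qed.

Lemma rel_trans R x y z : rel_of R x y -> rel_of R y z -> rel_of R x z.
Proof. by case: R => R [rR tR sR]; apply: tR. Qed.

Definition eq_le R S := forall x y, rel_of R x y -> rel_of S x y.

Lemma eq_le_joinl R S : eq_le R (eq_join R S).
Proof. by move=> x y Rxy; apply: t_step; left. Qed.

Lemma eq_le_joinr R S : eq_le S (eq_join R S).
Proof. by move=> x y Sxy; apply: t_step; right. Qed.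

Lemma eq_join_le R S T : eq_le R T -> eq_le S T -> eq_le (eq_join R S) T.
Proof.
move=> RT ST x y; elim=> [{}x {}y [/RT|/ST]|{}x {}y z _ xy _ yz] //.
exact: rel_trans xy yz.
Qed.

Definition gen_side b (g : fpgen O) : option (EqRel O) :=
  match b, g with
  | true, inl R => Some R
  | false, inr R => Some R
  | _, _ => None
  end.

Definition var b R : lterm (fpgen O) := LVar (if b then inl R else inr R).

(* The least element of the factor [b] above [t]; [None] stands for an added
   greatest element. *)
Fixpoint upper_cover b t : option (EqRel O) :=
  match t with
  | LVar g => gen_side b g
  | LMeet t1 t2 =>
      match upper_cover b t1, upper_cover b t2 with
      | Some R, Some Q => Some (eq_meet R Q)
      | Some R, None => Some R
      | None, v => v
      end
  | LJoin t1 t2 =>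
      match upper_cover b t1, upper_cover b t2 with
      | Some R, Some Q => Some (eq_join R Q)
      | _, _ => None
      end
  end.

(* The greatest element of the factor [b] below [t]; [None] stands for an added
   least element. *)
Fixpoint lower_cover b t : option (EqRel O) :=
  match t with
  | LVar g => gen_side b g
  | LMeet t1 t2 =>
      match lower_cover b t1, lower_cover b t2 with
      | Some R, Some Q => Some (eq_meet R Q)
      | _, _ => None
      end
  | LJoin t1 t2 =>
      match lower_cover b t1, lower_cover b t2 with
      | Some R, Some Q => Some (eq_join R Q)
      | Some R, None => Some R
      | None, v => v
      end
  end.

Definition cover_le (v w : option (EqRel O)) :=
  if (v, w) is (Some R, Some Q) then eq_le R Q else False.

Definition upper_le (v w : option (EqRel O)) :=
  if w is Some Q then if v is Some R then eq_le R Q else False else True.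

Definition lower_le (v w : option (EqRel O)) :=
  if v is Some R then if w is Some Q then eq_le R Q else False else True.

(* Dean's and Graetzer's solution of the word problem for free products of
   lattices: Whitman's condition, with comparisons inside a factor decided by
   the covers. *)
Inductive wle : lterm (fpgen O) -> lterm (fpgen O) -> Prop :=
| wle_cover b t s : cover_le (upper_cover b t) (lower_cover b s) -> wle t s
| wle_joinl t1 t2 s : wle t1 s -> wle t2 s -> wle (LJoin t1 t2) s
| wle_meetl1 t1 t2 s : wle t1 s -> wle (LMeet t1 t2) s
| wle_meetl2 t1 t2 s : wle t2 s -> wle (LMeet t1 t2) s
| wle_meetr t s1 s2 : wle t s1 -> wle t s2 -> wle t (LMeet s1 s2)
| wle_joinr1 t s1 s2 : wle t s1 -> wle t (LJoin s1 s2)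
| wle_joinr2 t s1 s2 : wle t s2 -> wle t (LJoin s1 s2).

Lemma wle_var b R S : eq_le R S -> wle (var b R) (var b S).
Proof. by move=> RS; apply: (@wle_cover b); case: b. Qed.

Lemma wle_refl t : wle t t.
Proof.
elim: t => [[R|R]|t1 W1 t2 W2|t1 W1 t2 W2].
- exact: (@wle_var true).
- exact: (@wle_var false).
- by apply: wle_meetr; [apply: wle_meetl1|apply: wle_meetl2].
- by apply: wle_joinl; [apply: wle_joinr1|apply: wle_joinr2].
Qed.

Ltac cover_cases :=
  repeat match goal with
  | |- context [upper_cover ?b ?t] => destruct (upper_cover b t)
  | |- context [lower_cover ?b ?t] => destruct (lower_cover b t)
  | H : context [upper_cover ?b ?t] |- _ => destruct (upper_cover b t)
  | H : context [lower_cover ?b ?t] |- _ => destruct (lower_cover b t)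
  end; simpl in *.

Lemma lower_le_upper b t R Q :
  lower_cover b t = Some R -> upper_cover b t = Some Q -> eq_le R Q.
Proof.
elim: t R Q => [g|t1 W1 t2 W2|t1 W1 t2 W2] R Q /=.
- by move=> -> [->].
- case E1: (lower_cover b t1) => [R1|] //; case E2: (lower_cover b t2) => [R2|] //.
  move=> [<-]; case F1: (upper_cover b t1) => [S1|]; case F2: (upper_cover b t2) => [S2|] //.
  + by move=> [<-] x y [xy1 xy2]; split; [exact: W1 E1 F1 _ _ xy1|exact: W2 E2 F2 _ _ xy2].
  + by move=> [<-] x y [xy1 xy2]; exact: W1 E1 F1 _ _ xy1.
  + by move=> [<-] x y [xy1 xy2]; exact: W2 E2 F2 _ _ xy2.
- case F1: (upper_cover b t1) => [S1|] //; case F2: (upper_cover b t2) => [S2|] //.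
  case E1: (lower_cover b t1) => [R1|]; case E2: (lower_cover b t2) => [R2|] //;
    move=> [<-] [<-].
  + apply: eq_join_le => x y xy.
      by apply: eq_le_joinl; exact: W1 E1 F1 _ _ xy.
    by apply: eq_le_joinr; exact: W2 E2 F2 _ _ xy.
  + by move=> x y xy; apply: eq_le_joinl; exact: W1 E1 F1 _ _ xy.
  + by move=> x y xy; apply: eq_le_joinr; exact: W2 E2 F2 _ _ xy.
Qed.

(** An element lying below some member of one factor has no member of the other factor below it;
    this settles the comparisons across factors in [wle_covers]. *)
Lemma upper_lower_disjoint b t R :
  upper_cover b t = Some R -> lower_cover (~~ b) t = None.
Proof.
elim: t R => [g|t1 W1 t2 W2|t1 W1 t2 W2] R /=.
- by case: b; case: g.
- case E1: (upper_cover b t1) => [R1|]; first by rewrite (W1 _ E1).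
  by move=> /W2->; case: (lower_cover _ t1).
- case E1: (upper_cover b t1) => [R1|] //; case E2: (upper_cover b t2) => [R2|] //.
  by rewrite (W1 _ E1) (W2 _ E2).
Qed.

(** Monotonicity of the covers, proved on derivations before transitivity is available; it is what
    lets the rule [wle_cover] compose with any other rule. *)
Lemma wle_covers t s b : wle t s ->
  upper_le (upper_cover b t) (upper_cover b s) /\
  lower_le (lower_cover b t) (lower_cover b s).
Proof.
elim=> {t s} [d t s|t1 t2 s _ [U1 L1] _ [U2 L2]|t1 t2 s _ [U1 L1]|t1 t2 s _ [U1 L1]
            |t s1 s2 _ [U1 L1] _ [U2 L2]|t s1 s2 _ [U1 L1]|t s1 s2 _ [U1 L1]] /=.
- case Et: (upper_cover d t) => [R|] //; case Es: (lower_cover d s) => [Q|] //= RS.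
  have [<-|/eqP ndb] := d =P b.
    split.
      rewrite Et; case Es': (upper_cover d s) => [S'|] //= x y /RS.
      exact: lower_le_upper Es Es' _ _.
    rewrite Es; case Et': (lower_cover d t) => [R'|] //= x y xy.
    by apply: RS; exact: lower_le_upper Et' Et _ _ xy.
  have {ndb}-> : b = ~~ d by case: (b) (d) ndb => [] [].
  rewrite (upper_lower_disjoint Et); split=> //.
  case E: (upper_cover (~~ d) s) => [S'|] //.
  by have := upper_lower_disjoint E; rewrite negbK Es.
all: split; cover_cases=> //; try exact: eq_join_le;
  try (by move=> x y xy; firstorder);
  by move=> x y xy; (apply: eq_le_joinl + apply: eq_le_joinr); auto.
Qed.

(** The half of cut elimination that runs on the second derivation. The two extra hypotheses supply
    the principal cases, where [s] is decomposed on both sides. *)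
Lemma wle_trans_right t s u : wle t s ->
  (forall s1 s2, s = LMeet s1 s2 ->
     forall v, wle s1 v \/ wle s2 v -> wle t v) ->
  (forall s1 s2, s = LJoin s1 s2 ->
     forall v, wle s1 v -> wle s2 v -> wle t v) ->
  wle s u -> wle t u.
Proof.
move=> + + + su; elim: su => {s u} [b s u su|s1 s2 u W1 _ W2 _|s1 s2 u W _|s1 s2 u W _
  |s u1 u2 _ IH1 _ IH2|s u1 u2 _ IH|s u1 u2 _ IH] ts Hm Hj.
- apply: (@wle_cover b); have [+ _] := wle_covers b ts.
  move: su; case: (upper_cover b s) => [R|] //=.
  case: (upper_cover b t) => [Q|] //=; case: (lower_cover b u) => [T|] //=.
  by move=> RT QR x y /QR/RT.
- exact: Hj W1 W2.
- by apply: (Hm _ _ erefl); left.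
- by apply: (Hm _ _ erefl); right.
- by apply: wle_meetr; [apply: IH1|apply: IH2].
- by apply: wle_joinr1; apply: IH.
- by apply: wle_joinr2; apply: IH.
Qed.

Lemma wle_trans s t u : wle t s -> wle s u -> wle t u.
Proof.
pose cut s := forall t u, wle t s -> wle s u -> wle t u.
(* Outer induction on the middle term; the inner one is on the derivation of [wle t s]. *)
suff H s' : (forall s1 s2, s' = LMeet s1 s2 \/ s' = LJoin s1 s2 -> cut s1 /\ cut s2) ->
    cut s'.
  move: s t u; elim=> [g|s1 C1 s2 C2|s1 C1 s2 C2]; apply: H => s1' s2' [] //.
    by move=> [<- <-].
  by move=> [<- <-].
move=> {s t u} IH t u ts; elim: ts IH u => {t s'} [b t s ts|t1 t2 s _ C1 _ C2|t1 t2 s _ C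
  |t1 t2 s _ C|t s1 s2 W1 _ W2 _|t s1 s2 W _|t s1 s2 W _] IH u su.
- apply: (@wle_cover b); have [_] := wle_covers b su.
  move: ts; case: (upper_cover b t) => [R|] //=.
  case: (lower_cover b s) => [Q|] //=; case: (lower_cover b u) => [T|] //=.
  by move=> RQ QT x y /RQ/QT.
- by apply: wle_joinl; [apply: C1|apply: C2].
- by apply: wle_meetl1; apply: C.
- by apply: wle_meetl2; apply: C.
- have [C1 C2] := IH _ _ (or_introl erefl).
  apply: wle_trans_right (wle_meetr W1 W2) _ _ su => // _ _ [<- <-] v [].
    exact: C1.
  exact: C2.
- have [C1 C2] := IH _ _ (or_intror erefl).
  apply: wle_trans_right (wle_joinr1 s2 W) _ _ su => // _ _ [<- <-] v + _.
  exact: C1.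
- have [C1 C2] := IH _ _ (or_intror erefl).
  apply: wle_trans_right (wle_joinr2 s1 W) _ _ su => // _ _ [<- <-] v _.
  exact: C2.
Qed.

(** Each generating identity is derivable in both directions, and cut elimination takes care of
    [fp_trans]. *)
Lemma fp_equiv_wle t s : fp_equiv t s -> wle t s /\ wle s t.
Proof.
have ml t1 t2 : wle (LMeet t1 t2) t1 by apply: wle_meetl1; apply: wle_refl.
have mr t1 t2 : wle (LMeet t1 t2) t2 by apply: wle_meetl2; apply: wle_refl.
have jl t1 t2 : wle t1 (LJoin t1 t2) by apply: wle_joinr1; apply: wle_refl.
have jr t1 t2 : wle t2 (LJoin t1 t2) by apply: wle_joinr2; apply: wle_refl.
elim=> {t s}
  [t|t s _ [ts st]|t s u _ [ts st] _ [su us]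
  |t t' s s' _ [tt' t't] _ [ss' s's]|t t' s s' _ [tt' t't] _ [ss' s's]
  |t s|t s|t s u|t s u|t s|t s|R Q RQ|R Q RQ|R Q|R Q|R Q|R Q].
- by split; apply: wle_refl.
- by [].
- by split; [exact: wle_trans su|exact: wle_trans st].
- by split; apply: wle_meetr; (apply: wle_meetl1 + apply: wle_meetl2); assumption.
- by split; apply: wle_joinl; (apply: wle_joinr1 + apply: wle_joinr2); assumption.
- by split; apply: wle_meetr.
- by split; apply: wle_joinl.
- split; repeat apply: wle_meetr => //.
  + by apply: wle_meetl2.
  + by apply: wle_meetl2.
  + by apply: wle_meetl1.
  + by apply: wle_meetl1.
- split; repeat apply: wle_joinl => //.
  + by apply: wle_joinr1.
  + by apply: wle_joinr1.
  + by apply: wle_joinr2.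
  + by apply: wle_joinr2.
- by split=> //; apply: wle_meetr => //; apply: wle_refl.
- by split=> //; apply: wle_joinl => //; apply: wle_refl.
- by split; apply: (@wle_var true) => x y /RQ.
- by split; apply: (@wle_var false) => x y /RQ.
- split; last by apply: (@wle_cover true).
  by apply: wle_meetr; apply: (@wle_var true) => x y [].
- split; first by apply: (@wle_cover true).
  apply: wle_joinl; apply: (@wle_var true); [exact: eq_le_joinl|exact: eq_le_joinr].
- split; last by apply: (@wle_cover false).
  by apply: wle_meetr; apply: (@wle_var false) => x y [].
- split; first by apply: (@wle_cover false).
  apply: wle_joinl; apply: (@wle_var false); [exact: eq_le_joinl|exact: eq_le_joinr].
Qed.

(** * The order of the coproduct and its agreement with [wle] *)

Definition fp_le t s := fp_equiv (LMeet t s) t.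

Lemma fp_meet_idem t : fp_equiv (LMeet t t) t.
Proof.
apply: fp_trans (fp_absorb_mj t (LMeet t t)).
by apply: fp_cong_meet; [exact: fp_refl|apply: fp_sym; exact: fp_absorb_jm].
Qed.

Lemma fp_le_join t s : fp_le t s <-> fp_equiv (LJoin t s) s.
Proof.
split=> H.
  apply: fp_trans (fp_absorb_jm s t).
  apply: fp_trans (fp_join_comm _ _) _; apply: fp_cong_join; first exact: fp_refl.
  by apply: fp_trans (fp_sym H) (fp_meet_comm _ _).
apply: fp_trans (fp_absorb_mj t s).
by apply: fp_cong_meet; [exact: fp_refl|exact: fp_sym].
Qed.

Lemma fp_le_trans s t u : fp_le t s -> fp_le s u -> fp_le t u.
Proof.
move=> ts su; apply: fp_trans (ts).
apply: fp_trans (fp_cong_meet (fp_sym ts) (fp_refl u)) _.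
apply: fp_trans (fp_sym (fp_meet_assoc _ _ _)) _.
by apply: fp_cong_meet; first exact: fp_refl.
Qed.

Lemma fp_le_of_equiv t s : fp_equiv t s -> fp_le t s.
Proof.
move=> ts; apply: fp_trans (fp_meet_idem t).
by apply: fp_cong_meet; [exact: fp_refl|exact: fp_sym].
Qed.

Lemma fp_le_antisym t s : fp_le t s -> fp_le s t -> fp_equiv t s.
Proof. by move=> ts; apply: fp_trans; apply: fp_trans (fp_sym ts) (fp_meet_comm _ _). Qed.

Lemma fp_le_meetl t s : fp_le (LMeet t s) t.
Proof.
apply: fp_trans (fp_meet_comm _ _) _; apply: fp_trans (fp_meet_assoc _ _ _) _.
by apply: fp_cong_meet; [exact: fp_meet_idem|exact: fp_refl].
Qed.

Lemma fp_le_meetr t s : fp_le (LMeet t s) s.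
Proof. exact: fp_le_trans (fp_le_of_equiv (fp_meet_comm _ _)) (fp_le_meetl _ _). Qed.

Lemma fp_le_meet t s u : fp_le t s -> fp_le t u -> fp_le t (LMeet s u).
Proof.
move=> ts tu; apply: fp_trans (fp_meet_assoc _ _ _) _.
by apply: fp_trans tu; apply: fp_cong_meet; last exact: fp_refl.
Qed.

Lemma fp_le_joinl t s : fp_le t (LJoin t s).
Proof. exact: fp_absorb_mj. Qed.

Lemma fp_le_joinr t s : fp_le s (LJoin t s).
Proof. exact: fp_le_trans (fp_le_joinl _ _) (fp_le_of_equiv (fp_join_comm _ _)). Qed.

Lemma fp_join_le t s u : fp_le t u -> fp_le s u -> fp_le (LJoin t s) u.
Proof.
move=> /fp_le_join tu /fp_le_join su; apply/fp_le_join.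
apply: fp_trans (fp_sym (fp_join_assoc _ _ _)) _.
by apply: fp_trans tu; apply: fp_cong_join; first exact: fp_refl.
Qed.

Lemma fp_var_meet b R Q : fp_equiv (var b (eq_meet R Q)) (LMeet (var b R) (var b Q)).
Proof. by case: b; [exact: fp_meet_l|exact: fp_meet_r]. Qed.

Lemma fp_var_join b R Q : fp_equiv (var b (eq_join R Q)) (LJoin (var b R) (var b Q)).
Proof. by case: b; [exact: fp_join_l|exact: fp_join_r]. Qed.

Lemma fp_var_le b R Q : eq_le R Q -> fp_le (var b R) (var b Q).
Proof.
move=> RQ; apply: fp_trans (fp_sym (fp_var_meet _ _ _)) _.
have E : same_eq (eq_meet R Q) R by move=> x y; split=> [[]|xy] //; split; auto.
by case: b; [apply: fp_same_l|apply: fp_same_r].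
Qed.

(** The operation tables of the factor match the recursion that computes the cover. *)
Lemma fp_le_upper_cover b t R : upper_cover b t = Some R -> fp_le t (var b R).
Proof.
elim: t R => [g|t1 W1 t2 W2|t1 W1 t2 W2] R /=.
- by case: b; case: g => // Q [->]; apply: fp_meet_idem.
- case E1: (upper_cover b t1) => [R1|]; case E2: (upper_cover b t2) => [R2|] // [<-].
  + apply: fp_le_trans (fp_le_of_equiv (fp_sym (fp_var_meet _ _ _))).
    apply: fp_le_meet; first exact: fp_le_trans (fp_le_meetl _ _) (W1 _ E1).
    exact: fp_le_trans (fp_le_meetr _ _) (W2 _ E2).
  + exact: fp_le_trans (fp_le_meetl _ _) (W1 _ E1).
  + exact: fp_le_trans (fp_le_meetr _ _) (W2 _ E2).
- case E1: (upper_cover b t1) => [R1|] //; case E2: (upper_cover b t2) => [R2|] // [<-].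
  apply: fp_le_trans (fp_le_of_equiv (fp_sym (fp_var_join _ _ _))).
  apply: fp_join_le; first exact: fp_le_trans (W1 _ E1) (fp_le_joinl _ _).
  exact: fp_le_trans (W2 _ E2) (fp_le_joinr _ _).
Qed.

Lemma fp_le_lower_cover b t R : lower_cover b t = Some R -> fp_le (var b R) t.
Proof.
elim: t R => [g|t1 W1 t2 W2|t1 W1 t2 W2] R /=.
- by case: b; case: g => // Q [->]; apply: fp_meet_idem.
- case E1: (lower_cover b t1) => [R1|] //; case E2: (lower_cover b t2) => [R2|] // [<-].
  apply: fp_le_trans (fp_le_of_equiv (fp_var_meet _ _ _)) _.
  apply: fp_le_meet; first exact: fp_le_trans (fp_le_meetl _ _) (W1 _ E1).
  exact: fp_le_trans (fp_le_meetr _ _) (W2 _ E2).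
- case E1: (lower_cover b t1) => [R1|]; case E2: (lower_cover b t2) => [R2|] // [<-].
  + apply: fp_le_trans (fp_le_of_equiv (fp_var_join _ _ _)) _.
    apply: fp_join_le; first exact: fp_le_trans (W1 _ E1) (fp_le_joinl _ _).
    exact: fp_le_trans (W2 _ E2) (fp_le_joinr _ _).
  + exact: fp_le_trans (W1 _ E1) (fp_le_joinl _ _).
  + exact: fp_le_trans (W2 _ E2) (fp_le_joinr _ _).
Qed.

Lemma wle_fp_le t s : wle t s -> fp_le t s.
Proof.
elim=> {t s} [b t s|t1 t2 s _ L1 _ L2|t1 t2 s _ L|t1 t2 s _ L|t s1 s2 _ L1 _ L2
  |t s1 s2 _ L|t s1 s2 _ L].
- case Et: (upper_cover b t) => [R|] //; case Es: (lower_cover b s) => [Q|] //= RQ.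
  apply: fp_le_trans (fp_le_upper_cover Et) _.
  exact: fp_le_trans (fp_var_le b RQ) (fp_le_lower_cover Es).
- exact: fp_join_le.
- exact: fp_le_trans (fp_le_meetl _ _) L.
- exact: fp_le_trans (fp_le_meetr _ _) L.
- exact: fp_le_meet.
- exact: fp_le_trans L (fp_le_joinl _ _).
- exact: fp_le_trans L (fp_le_joinr _ _).
Qed.

Lemma fp_equivP t s : fp_equiv t s <-> wle t s /\ wle s t.
Proof.
split; first exact: fp_equiv_wle.
by move=> [/wle_fp_le ts /wle_fp_le st]; exact: fp_le_antisym.
Qed.

Lemma wle_meet_inv t1 t2 s : wle (LMeet t1 t2) s ->
  [\/ exists b, cover_le (upper_cover b (LMeet t1 t2)) (lower_cover b s),
      wle t1 s \/ wle t2 s,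
      exists s1 s2, [/\ s = LMeet s1 s2, wle (LMeet t1 t2) s1
        & wle (LMeet t1 t2) s2]
    | exists s1 s2, s = LJoin s1 s2 /\
        (wle (LMeet t1 t2) s1 \/ wle (LMeet t1 t2) s2)].
Proof.
move E: (LMeet t1 t2) => t ts; case: ts E => {t s}.
- by move=> b t s H _; constructor 1; exists b.
- by [].
- by move=> ? ? s H [-> _]; constructor 2; left.
- by move=> ? ? s H [_ ->]; constructor 2; right.
- by move=> t s1 s2 H1 H2 _; constructor 3; exists s1, s2.
- by move=> t s1 s2 H _; constructor 4; exists s1, s2; split=> //; left.
- by move=> t s1 s2 H _; constructor 4; exists s1, s2; split=> //; right.
Qed.

Lemma wle_var_join_inv g s1 s2 : wle (LVar g) (LJoin s1 s2) ->
  [\/ exists b, cover_le (upper_cover b (LVar g)) (lower_cover b (LJoin s1 s2)),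
      wle (LVar g) s1 | wle (LVar g) s2].
Proof.
move E: (LVar g) => t; move F: (LJoin s1 s2) => s ts; case: ts E F => {t s} //.
- by move=> b t s H _ _; constructor 1; exists b.
- by move=> t ? ? H _ [-> _]; constructor 2.
- by move=> t ? ? H _ [_ ->]; constructor 3.
Qed.

(** * Compact elements: density and compactness *)

Lemma gen_equivalence (p q : O) :
  equivalence O (fun x y => x = y \/ (x = p \/ x = q) /\ (y = p \/ y = q)).
Proof.
split=> [x|x y z|x y]; first by left.
  by move=> [->|[xp yp]] [<-|[yp' zp]]; auto.
by move=> [->|[xp yp]]; auto.
Qed.

(** The principal equivalence generated by [(p, q)]; it is the diagonal when [p = q]. *)
Definition gen_eq (p q : O) : EqRel O := exist _ _ (gen_equivalence p q).

Lemma gen_eq_le p q R : rel_of R p q -> eq_le (gen_eq p q) R.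
Proof.
move=> Rpq x y [->|[[]-> []->]] //; try exact: rel_refl.
exact: rel_sym.
Qed.

Lemma gen_eq_mem p q : rel_of (gen_eq p q) p q.
Proof. by right; split; [left|right]. Qed.

(* Membership in a cover; [None] is a point that belongs to the added greatest
   element only. *)
Definition upper_mem b t (z : option (O * O)) : Prop :=
  if upper_cover b t is Some R then
    if z is Some (p, q) then rel_of R p q else False
  else True.

Definition lower_mem b t (z : option (O * O)) : Prop :=
  if (lower_cover b t, z) is (Some R, Some (p, q)) then rel_of R p q else False.

Lemma upper_mem_le b t s z : wle t s -> upper_mem b t z -> upper_mem b s z.
Proof.
move=> /(wle_covers b)[+ _]; rewrite /upper_mem.
case: (upper_cover b s) => [Q|] //; case: (upper_cover b t) => [R|] //= RQ.
by case: z => [[p q]|] //; apply: RQ.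
Qed.

Lemma lower_mem_le b t s z : wle t s -> lower_mem b t z -> lower_mem b s z.
Proof.
move=> /(wle_covers b)[_]; rewrite /lower_mem.
case: (lower_cover b t) => [R|] //; case: (lower_cover b s) => [Q|] //= RQ.
by case: z => [[p q]|] //; apply: RQ.
Qed.

Lemma upper_mem_trans b t p q r :
  upper_mem b t (Some (p, q)) -> upper_mem b t (Some (q, r)) ->
  upper_mem b t (Some (p, r)).
Proof. by rewrite /upper_mem; case: (upper_cover b t) => // R; apply: rel_trans. Qed.

Lemma lower_mem_trans b t p q r :
  lower_mem b t (Some (p, q)) -> lower_mem b t (Some (q, r)) ->
  lower_mem b t (Some (p, r)).
Proof. by rewrite /lower_mem; case: (lower_cover b t) => // R; apply: rel_trans. Qed.

Lemma lower_mem_wle b t p q :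
  lower_mem b t (Some (p, q)) <-> wle (var b (gen_eq p q)) t.
Proof.
split=> [|/(@lower_mem_le b _ _ (Some (p, q)))]; last first.
  by apply; rewrite /lower_mem; case: (b); exact: gen_eq_mem.
rewrite /lower_mem; case E: (lower_cover b t) => [R|] // Rpq.
by apply: (@wle_cover b); rewrite E; case: (b); exact: gen_eq_le.
Qed.

(* The image of [emb] consists of the compact elements. *)
Fixpoint emb (k : lterm (bool * (O * O))) : lterm (fpgen O) :=
  match k with
  | LVar (b, (p, q)) => var b (gen_eq p q)
  | LMeet k1 k2 => LMeet (emb k1) (emb k2)
  | LJoin k1 k2 => LJoin (emb k1) (emb k2)
  end.

Variable o : O.

(** Pointwise inclusion also detects missing covers: [None] lies in an absent upper cover but in no
    lower cover, and [(o, o)] lies in every upper cover but in no absent lower cover. *)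
Lemma cover_leP b t s :
  cover_le (upper_cover b t) (lower_cover b s) <->
  forall z, upper_mem b t z -> lower_mem b s z.
Proof.
rewrite /upper_mem /lower_mem; case: (upper_cover b t) => [R|]; last first.
  by split=> // /(_ None I); case: (lower_cover b s).
split; first by case: (lower_cover b s) => [Q|] // RQ [[p q]|] //; exact: RQ.
move=> H; have := H (Some (o, o)) (rel_refl _ _).
case: (lower_cover b s) H => [Q|] // H _ p q; exact: (H (Some (p, q))).
Qed.

(** The least element of the coproduct, as the meet of the diagonals of the two copies. *)
Definition kbot : lterm (bool * (O * O)) :=
  LMeet (LVar (true, (o, o))) (LVar (false, (o, o))).

Lemma kbot_le t : wle (emb kbot) t.
Proof.
elim: t => [[R|R]|t1 W1 t2 W2|t1 W1 t2 W2].
- by apply: wle_meetl1; apply: (@wle_var true); apply: gen_eq_le; exact: rel_refl.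
- by apply: wle_meetl2; apply: (@wle_var false); apply: gen_eq_le; exact: rel_refl.
- exact: wle_meetr.
- exact: wle_joinr1.
Qed.

(** A pair in a join of equivalences is reached by a finite chain, so joining compact approximants
    of its links suffices. *)
Lemma upper_mem_approx b t z : upper_mem b t z ->
  exists k, wle (emb k) t /\ upper_mem b (emb k) z.
Proof.
elim: t z => [g|t1 IH1 t2 IH2|t1 IH1 t2 IH2] z.
- have loop R c : wle (var c (gen_eq o o)) (var c R).
    by apply: wle_var; apply: gen_eq_le; exact: rel_refl.
  case: g => R; rewrite /upper_mem; case: b => /= H.
  + case: z H => [[p q]|] // H; exists (LVar (true, (p, q))).
    by split; [apply: (@wle_var true); exact: gen_eq_le|exact: gen_eq_mem].
  + by exists (LVar (true, (o, o))); split; [exact: (loop _ true)|].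
  + by exists (LVar (false, (o, o))); split; [exact: (loop _ false)|].
  + case: z H => [[p q]|] // H; exists (LVar (false, (p, q))).
    by split; [apply: (@wle_var false); exact: gen_eq_le|exact: gen_eq_mem].
- move=> H.
  have [|k1 [kt1 H1]] := IH1 z.
    by apply: upper_mem_le H; apply: wle_meetl1; exact: wle_refl.
  have [|k2 [kt2 H2]] := IH2 z.
    by apply: upper_mem_le H; apply: wle_meetl2; exact: wle_refl.
  exists (LMeet k1 k2); split.
    by apply: wle_meetr; [apply: wle_meetl1|apply: wle_meetl2].
  move: H1 H2; rewrite /upper_mem /=.
  case: (upper_cover b (emb k1)) => [R1|]; case: (upper_cover b (emb k2)) => [R2|] //.
  by case: z {H} => [[p q]|].
- rewrite {1}/upper_mem /=.
  have or1 : upper_mem b t1 z ->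
      exists k, wle (emb k) (LJoin t1 t2) /\ upper_mem b (emb k) z.
    by move=> /IH1[k [kt H]]; exists k; split=> //; exact: wle_joinr1.
  have or2 : upper_mem b t2 z ->
      exists k, wle (emb k) (LJoin t1 t2) /\ upper_mem b (emb k) z.
    by move=> /IH2[k [kt H]]; exists k; split=> //; exact: wle_joinr2.
  case E1: (upper_cover b t1) => [R1|]; last first.
    by move=> _; apply: or1; rewrite /upper_mem E1.
  case E2: (upper_cover b t2) => [R2|]; last first.
    by move=> _; apply: or2; rewrite /upper_mem E2.
  case: z {or1 or2} => [[p q]|] //=; elim=> {p q} [p q [H|H]|p q r _ + _].
  + have [|k [kt Hk]] := IH1 (Some (p, q)); first by rewrite /upper_mem E1.
    by exists k; split=> //; exact: wle_joinr1.
  + have [|k [kt Hk]] := IH2 (Some (p, q)); first by rewrite /upper_mem E2.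
    by exists k; split=> //; exact: wle_joinr2.
  + move=> [k1 [kt1 H1]] [k2 [kt2 H2]]; exists (LJoin k1 k2).
    split; first exact: wle_joinl.
    apply: (@upper_mem_trans _ _ _ q).
      by apply: upper_mem_le H1; apply: wle_joinr1; exact: wle_refl.
    by apply: upper_mem_le H2; apply: wle_joinr2; exact: wle_refl.
Qed.

(** Induction on [t]. The hard case is a meet not below [s]: finitely many compact elements, each
    refuting one possible last rule of a derivation, are combined into one compact element below the
    meet but not below [s]. *)
Lemma wle_density t s :
  (forall k, wle (emb k) t -> wle (emb k) s) -> wle t s.
Proof.
elim: t s => [g|t1 IH1 t2 IH2|t1 IH1 t2 IH2] s H.
- suff [b [R [Eg RS]]] : exists b R, LVar g = var b R /\
      forall p q, rel_of R p q -> wle (var b (gen_eq p q)) s.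
    rewrite Eg; apply: (@wle_cover b); apply/cover_leP => z.
    rewrite /upper_mem; case: (b) (@lower_mem_wle b s) RS => /= L RS;
      by case: z => [[p q]|] // /RS/L.
  case: g H => R H; [exists true, R|exists false, R]; split=> // p q Rpq.
    by apply: (H (LVar (true, (p, q)))); apply: (@wle_var true); exact: gen_eq_le.
  by apply: (H (LVar (false, (p, q)))); apply: (@wle_var false); exact: gen_eq_le.
(* [ks] is the witness against the two rules that decompose a join on the right. *)
- have main s' ks : (forall k, wle (emb k) (LMeet t1 t2) -> wle (emb k) s') ->
      wle (emb ks) (LMeet t1 t2) ->
      (forall s1 s2, s' <> LMeet s1 s2) ->
      (forall s1 s2, s' = LJoin s1 s2 -> ~ wle (emb ks) s1 /\ ~ wle (emb ks) s2) ->
      wle (LMeet t1 t2) s'.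
    move=> {}H kst Nm Nj; apply: contrapT => N.
    have [k1 [kt1 Nk1]] : exists k, wle (emb k) t1 /\ ~ wle (emb k) s'.
      apply: contrapT => Nk; apply: N; apply: wle_meetl1; apply: IH1 => k kt.
      by apply: contrapT => Nks; apply: Nk; exists k.
    have [k2 [kt2 Nk2]] : exists k, wle (emb k) t2 /\ ~ wle (emb k) s'.
      apply: contrapT => Nk; apply: N; apply: wle_meetl2; apply: IH2 => k kt.
      by apply: contrapT => Nks; apply: Nk; exists k.
    have cov b : exists k z, [/\ wle (emb k) (LMeet t1 t2), upper_mem b (emb k) z
        & ~ lower_mem b s' z].
      apply: contrapT => Nk; apply: N; apply: (@wle_cover b); apply/cover_leP => z.
      move=> /upper_mem_approx[k [kt kz]].
      by apply: contrapT => Nz; apply: Nk; exists k, z.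
    have [kT [zT [kTt kTz NT]]] := cov true; have [kF [zF [kFt kFz NF]]] := cov false.
    (* [K] joins the witnesses against the cover rule of each factor with [ks]. The meet of [k1]
       joined with [K] and [k2] joined with [K] lies below [t1] and [t2] and above [K]; [k1] and
       [k2] refute the left meet rules. *)
    pose K := LJoin (LJoin kT kF) ks.
    have Kt : wle (emb K) (LMeet t1 t2) by repeat apply: wle_joinl.
    have KK : wle (emb K) (emb (LMeet (LJoin k1 K) (LJoin k2 K))).
      by apply: wle_meetr; apply: wle_joinr2; exact: wle_refl.
    have ksK : wle (emb ks) (emb K) by apply: wle_joinr2; exact: wle_refl.
    have : wle (emb (LMeet (LJoin k1 K) (LJoin k2 K))) s'.
      apply: H; apply: wle_meetr; [apply: wle_meetl1|apply: wle_meetl2];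
        apply: wle_joinl => //; apply: wle_trans Kt _.
        by apply: wle_meetl1; exact: wle_refl.
      by apply: wle_meetl2; exact: wle_refl.
    move=> W; case: (wle_meet_inv W) => [[b /cover_leP C]|[Ws|Ws]|[s1 [s2 [E _ _]]]
      |[s1 [s2 [E Ws]]]].
    + case: b C => C; [apply: NT|apply: NF]; apply: C.
        apply: upper_mem_le kTz; apply: wle_trans _ KK.
        by apply: wle_joinr1; apply: wle_joinr1; exact: wle_refl.
      apply: upper_mem_le kFz; apply: wle_trans _ KK.
      by apply: wle_joinr1; apply: wle_joinr2; exact: wle_refl.
    + by apply: Nk1; apply: wle_trans Ws; apply: wle_joinr1; exact: wle_refl.
    + by apply: Nk2; apply: wle_trans Ws; apply: wle_joinr1; exact: wle_refl.
    + exact: Nm E.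
    + have [N1 N2] := Nj _ _ E.
      by case: Ws => Ws; [apply: N1|apply: N2]; apply: wle_trans (wle_trans ksK KK) Ws.
  elim: s H => [g|s1 J1 s2 J2|s1 J1 s2 J2] H.
  + exact: main H (kbot_le _) _ _.
  + by apply: wle_meetr; [apply: J1|apply: J2] => k /H W;
      apply: wle_trans W _; [apply: wle_meetl1|apply: wle_meetl2]; exact: wle_refl.
  + apply: contrapT => N.
    have [k1 [kt1 Nk1]] : exists k, wle (emb k) (LMeet t1 t2) /\ ~ wle (emb k) s1.
      apply: contrapT => Nk; apply: N; apply: wle_joinr1; apply: J1 => k kt.
      by apply: contrapT => Nks; apply: Nk; exists k.
    have [k2 [kt2 Nk2]] : exists k, wle (emb k) (LMeet t1 t2) /\ ~ wle (emb k) s2.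
      apply: contrapT => Nk; apply: N; apply: wle_joinr2; apply: J2 => k kt.
      by apply: contrapT => Nks; apply: Nk; exists k.
    (* By induction on [s], the meet is not below [s1] or [s2] as witnessed by [k1] and [k2]; their
       join refutes both at once. *)
    apply: N; apply: (main _ (LJoin k1 k2)) => //; first exact: wle_joinl.
    move=> _ _ [<- <-]; split=> W.
      by apply: Nk1; apply: wle_trans W; apply: wle_joinr1; exact: wle_refl.
    by apply: Nk2; apply: wle_trans W; apply: wle_joinr2; exact: wle_refl.
- apply: wle_joinl; [apply: IH1|apply: IH2] => k kt; apply: H.
    exact: wle_joinr1.
  exact: wle_joinr2.
Qed.

Definition finite_support R :=
  exists l : list O, forall x y, rel_of R x y -> x = y \/ In x l /\ In y l.

(** Finitely many principal equivalences enter a compact term, so an inclusion of its cover is a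
    condition on finitely many pairs. *)
Lemma emb_finite_support b k R :
  upper_cover b (emb k) = Some R -> finite_support R.
Proof.
elim: k R => [[c [p q]]|k1 IH1 k2 IH2|k1 IH1 k2 IH2] R /=.
- move=> E; have -> : R = gen_eq p q by case: b c E => [] [] //= [].
  exists (p :: q :: nil) => x y [->|[[]-> []->]]; rewrite /=; tauto.
- case: (upper_cover b (emb k1)) IH1 => [R1|] IH1;
    case: (upper_cover b (emb k2)) IH2 => [R2|] IH2 // [<-].
  + by have [l Hl] := IH1 _ erefl; exists l => x y [/Hl].
  + exact: IH1.
  + exact: IH2.
- case: (upper_cover b (emb k1)) IH1 => [R1|] // /(_ _ erefl)[l1 H1].
  case: (upper_cover b (emb k2)) IH2 => [R2|] // /(_ _ erefl)[l2 H2] [<-].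
  exists (l1 ++ l2)%list => x y; elim=> {x y} [x y [/H1|/H2]|x y z _ H _ H'].
  + by case=> [|[? ?]]; [left|right; split; apply: in_or_app; left].
  + by case=> [|[? ?]]; [left|right; split; apply: in_or_app; right].
  + case: H => [->|[? ?]] //; case: H' => [<-|[? ?]]; first by right.
    by right.
Qed.

(** Each pair in the lower cover of the join is a finite chain of pairs below [s1] or [s2], and
    every such pair is a compact generator; the approximants for the members of [l] are joined. *)
Lemma lower_join_approx b s1 s2 (l : list (O * O)) :
  exists k1 k2, [/\ wle (emb k1) s1, wle (emb k2) s2 &
    forall p q, In (p, q) l -> lower_mem b (LJoin s1 s2) (Some (p, q)) ->
      lower_mem b (emb (LJoin k1 k2)) (Some (p, q))].
Proof.
have joins k1 k2 k1' k2' : wle (emb k1) s1 -> wle (emb k2) s2 ->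
    wle (emb k1') s1 -> wle (emb k2') s2 ->
    [/\ wle (emb (LJoin k1 k1')) s1, wle (emb (LJoin k2 k2')) s2,
      wle (emb (LJoin k1 k2)) (emb (LJoin (LJoin k1 k1') (LJoin k2 k2'))) &
      wle (emb (LJoin k1' k2')) (emb (LJoin (LJoin k1 k1') (LJoin k2 k2')))].
  move=> H1 H2 H1' H2'; split; apply: wle_joinl => //.
  - by apply: wle_joinr1; apply: wle_joinr1; exact: wle_refl.
  - by apply: wle_joinr2; apply: wle_joinr1; exact: wle_refl.
  - by apply: wle_joinr1; apply: wle_joinr2; exact: wle_refl.
  - by apply: wle_joinr2; apply: wle_joinr2; exact: wle_refl.
have left1 p q : lower_mem b s1 (Some (p, q)) ->
    exists k1 k2, [/\ wle (emb k1) s1, wle (emb k2) s2 &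
      lower_mem b (emb (LJoin k1 k2)) (Some (p, q))].
  move=> H; exists (LVar (b, (p, q))), kbot; split; last 2 first.
  - exact: kbot_le.
  - by apply/lower_mem_wle; apply: wle_joinr1; exact: wle_refl.
  - exact/lower_mem_wle.
have right1 p q : lower_mem b s2 (Some (p, q)) ->
    exists k1 k2, [/\ wle (emb k1) s1, wle (emb k2) s2 &
      lower_mem b (emb (LJoin k1 k2)) (Some (p, q))].
  move=> H; exists kbot, (LVar (b, (p, q))); split; first exact: kbot_le.
  - exact/lower_mem_wle.
  - by apply/lower_mem_wle; apply: wle_joinr2; exact: wle_refl.
have one p q : lower_mem b (LJoin s1 s2) (Some (p, q)) ->
    exists k1 k2, [/\ wle (emb k1) s1, wle (emb k2) s2 &
      lower_mem b (emb (LJoin k1 k2)) (Some (p, q))].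
  move: left1 right1; rewrite {1 3 5}/lower_mem /=.
  case: (lower_cover b s1) => [R1|]; case: (lower_cover b s2) => [R2|] // left1 right1.
  + elim=> {p q} [p q [/left1|/right1]|p q r _ + _] //.
    move=> [k1 [k2 [A1 A2 A]]] [k1' [k2' [B1 B2 B]]].
    have [C1 C2 C C'] := joins _ _ _ _ A1 A2 B1 B2.
    exists (LJoin k1 k1'), (LJoin k2 k2'); split=> //.
    exact: lower_mem_trans (lower_mem_le C A) (lower_mem_le C' B).
  + exact: left1.
  + exact: right1.
elim: l => [|[p q] l [k1 [k2 [A1 A2 A]]]].
  by exists kbot, kbot; split; try exact: kbot_le.
have [/one[k1' [k2' [B1 B2 B]]]|N] := pselect (lower_mem b (LJoin s1 s2) (Some (p, q))).
  have [C1 C2 C C'] := joins _ _ _ _ A1 A2 B1 B2.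
  exists (LJoin k1 k1'), (LJoin k2 k2'); split=> // p' q' [[<- <-]|Hl] H.
    exact: lower_mem_le B.
  by apply: lower_mem_le (A _ _ Hl H).
by exists k1, k2; split=> // p' q' [[<- <-]|] //; exact: A.
Qed.

(** Induction on [k]. Whitman's condition is what makes compactness survive meets: a meet below a
    join does so by a cover, or through one of the four subterms. *)
Lemma wle_join_compact k s1 s2 : wle (emb k) (LJoin s1 s2) ->
  exists k1 k2, [/\ wle (emb k1) s1, wle (emb k2) s2 &
    wle (emb k) (emb (LJoin k1 k2))].
Proof.
have cov b k' : cover_le (upper_cover b (emb k')) (lower_cover b (LJoin s1 s2)) ->
    exists k1 k2, [/\ wle (emb k1) s1, wle (emb k2) s2 &
      wle (emb k') (emb (LJoin k1 k2))].
  case E: (upper_cover b (emb k')) => [R|] // H.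
  have [l Hl] := emb_finite_support E; rewrite -E in H; move/cover_leP in H.
  (* The pair [(o, o)] forces the lower cover of the approximant to exist, which takes care of all
     diagonal pairs. *)
  have [k1 [k2 [A1 A2 A]]] := lower_join_approx b s1 s2 ((o, o) :: list_prod l l).
  exists k1, k2; split=> //; apply: (@wle_cover b); apply/cover_leP => -[[x y]|];
    last by rewrite /upper_mem E.
  move=> Hxy; have [xy|[xl yl]] : x = y \/ In x l /\ In y l.
  - by apply: Hl; move: Hxy; rewrite /upper_mem E.
  - subst y; have : lower_mem b (emb (LJoin k1 k2)) (Some (o, o)).
      apply: A; first by left.
      by apply: H; rewrite /upper_mem E; exact: rel_refl.
    by rewrite /lower_mem; case: (lower_cover b _) => // Q _; exact: rel_refl.
  - by apply: A; [right; exact: in_prod|exact: H].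
have l1 k' : wle (emb k') s1 -> exists k1 k2, [/\ wle (emb k1) s1, wle (emb k2) s2 &
      wle (emb k') (emb (LJoin k1 k2))].
  move=> H; exists k', kbot; split=> //; first exact: kbot_le.
  by apply: wle_joinr1; exact: wle_refl.
have l2 k' : wle (emb k') s2 -> exists k1 k2, [/\ wle (emb k1) s1, wle (emb k2) s2 &
      wle (emb k') (emb (LJoin k1 k2))].
  move=> H; exists kbot, k'; split=> //; first exact: kbot_le.
  by apply: wle_joinr2; exact: wle_refl.
elim: k => [[c [p q]]|k IH k' IH'|k IH k' IH'] H.
- case: (wle_var_join_inv H) => [[b H']|H'|H'].
  + exact: (cov b (LVar (c, (p, q)))).
  + exact: (l1 (LVar (c, (p, q)))).
  + exact: (l2 (LVar (c, (p, q)))).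
- case: (wle_meet_inv H) => [[b H']|[/IH|/IH']|[? [? []]] //
    |[? [? [[<- <-] [H'|H']]]]].
  + exact: (cov b (LMeet k k')).
  + by move=> [k1 [k2 [A1 A2 A]]]; exists k1, k2; split=> //; exact: wle_meetl1.
  + by move=> [k1 [k2 [A1 A2 A]]]; exists k1, k2; split=> //; exact: wle_meetl2.
  + exact: (l1 (LMeet k k')).
  + exact: (l2 (LMeet k k')).
- have [|k1 [k2 [A1 A2 A]]] := IH.
    by apply: wle_trans H; apply: wle_joinr1; exact: wle_refl.
  have [|k1' [k2' [B1 B2 B]]] := IH'.
    by apply: wle_trans H; apply: wle_joinr2; exact: wle_refl.
  exists (LJoin k1 k1'), (LJoin k2 k2'); split; try exact: wle_joinl.
  apply: wle_joinl; [apply: wle_trans A _|apply: wle_trans B _]; apply: wle_joinl.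
  + by apply: wle_joinr1; apply: wle_joinr1; exact: wle_refl.
  + by apply: wle_joinr2; apply: wle_joinr1; exact: wle_refl.
  + by apply: wle_joinr1; apply: wle_joinr2; exact: wle_refl.
  + by apply: wle_joinr2; apply: wle_joinr2; exact: wle_refl.
Qed.

End FreeProductOrder.

(** * The set of points *)

Section Points.
Variables (K T : Type) (le : K -> T -> Prop).

Inductive position := P1 | P2 | P3.

(* [node P1 x y a b], [node P2 x y a b] and [node P3 x y a b] are the inner
   points of a path x -a- _ -b- _ -a- _ -b- y. *)
Inductive point :=
| origin
| node (i : position) (x y : point) (a b : K).

Fixpoint depth p : nat :=
  if p is node _ x y _ _ then (maxn (depth x) (depth y)).+1 else 0.

(** At stage [n] a point of depth at most [n] is old and has no cell; a newer one belongs to the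
    cell of its path. *)
Definition cell n p : option (position * (point * point * K * K)) :=
  if p is node i x y a b then
    if depth p <= n then None else Some (i, (x, y, a, b))
  else None.

(** The old end through which a new point is reached from outside its path. Nodes are formed for all
    labels, so when the distance of [x] and [y] is not bounded by the join of [a] and [b], the third
    point hangs on [x]. *)
Definition anchor (E : point -> point -> T -> Prop) n p : point :=
  match cell n p with
  | None => p
  | Some (P3, (x, y, a, b)) =>
      if `[< forall t, le a t -> le b t -> E x y t >] then y else x
  | Some (_, (x, _, _, _)) => x
  end.

(** The distance of a point from its anchor is at most [t]. *)
Definition cost n p t : Prop :=
  match cell n p with
  | None => True
  | Some (P1, (_, _, a, _)) => le a t
  | Some (P2, (_, _, a, b)) => le a t /\ le b t
  | Some (P3, (_, _, _, b)) => le b t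
  end.

(** Distances within one path; [c.1.2] is its label [a] and [c.2] its label [b]. *)
Definition gap i j (c : point * point * K * K) t : Prop :=
  match i, j with
  | P1, P2 | P2, P1 => le c.2 t
  | P2, P3 | P3, P2 => le c.1.2 t
  | P1, P3 | P3, P1 => le c.1.2 t /\ le c.2 t
  | _, _ => True
  end.

Definition far (E : point -> point -> T -> Prop) n p q t : Prop :=
  [/\ cost n p t, E (anchor E n p) (anchor E n q) t & cost n q t].

(* A distance is represented by the set of elements above it: [E p q t] says that
   the distance of [p] and [q] is at most [t].  Points of depth [n.+1] are far
   from everything outside their own path. *)
Definition extend (E : point -> point -> T -> Prop) n p q t : Prop :=
  match cell n p, cell n q with
  | Some (i, c), Some (j, d) => if `[< c = d >] then gap i j c t else far E n p q t
  | _, _ => far E n p q t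
  end.

(** Stage [n] is intended for points of depth at most [n], deeper ones receiving default values; at
    depth 0 there is only [origin]. *)
Fixpoint close n : point -> point -> T -> Prop :=
  if n is n'.+1 then extend (close n') n' else fun _ _ _ => True.

Definition dist_le p q t := close (maxn (depth p) (depth q)) p q t.

(** * The triangle inequality at each stage, and independence of the stage *)

Definition same_cell n p q c :=
  exists i j, cell n p = Some (i, c) /\ cell n q = Some (j, c).

Lemma extend_same E n p q i j c t :
  cell n p = Some (i, c) -> cell n q = Some (j, c) ->
  extend E n p q t = gap i j c t.
Proof. by rewrite /extend => -> ->; rewrite asboolT. Qed.

Lemma extend_far E n p q t :
  ~ (exists c, same_cell n p q c) -> extend E n p q t = far E n p q t.
Proof.
rewrite /extend => N; case Ep: (cell n p) => [[i c]|] //.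
case Eq: (cell n q) => [[j d]|] //; case: asboolP => // cd; case: N.
by exists c, i, j; rewrite Ep Eq cd.
Qed.

Lemma same_cell_cost n p q i j c t :
  cell n p = Some (i, c) -> cell n q = Some (j, c) ->
  cost n p t -> cost n q t -> gap i j c t.
Proof.
rewrite /cost => -> ->; case: c => [[[x y] a] b].
by case: i; case: j => //=; tauto.
Qed.

(** Two points of a path have different anchors only if one of them is the third and hangs on [y].
    The gap and the cost together then put both labels below [t], which is the condition under which
    [x] and [y] are close. *)
Lemma same_cell_gap E n p q i j c t :
  (forall x, E x x t) -> (forall x y, E x y t -> E y x t) ->
  cell n p = Some (i, c) -> cell n q = Some (j, c) ->
  gap i j c t -> cost n q t ->
  cost n p t /\ E (anchor E n p) (anchor E n q) t.
Proof.
move=> Er Es; rewrite /cost /anchor => -> ->; case: c => [[[x y] a] b].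
case: i; case: j => //=; try (case: asboolP => H).
all: move=> Hg Hc; split; try tauto; try exact: Er.
all: by first [apply: H; tauto | apply: Es; apply: H; tauto].
Qed.

Lemma extend_refl E n p t : (forall x, E x x t) -> extend E n p p t.
Proof.
move=> Er; case Ep: (cell n p) => [[i c]|].
  by rewrite (extend_same _ _ Ep Ep); case: i {Ep}.
by rewrite /extend Ep /far /cost Ep.
Qed.

Lemma gap_sym i j c t : gap i j c t -> gap j i c t.
Proof. by case: i; case: j. Qed.

Lemma extend_sym E n p q t : (forall x y, E x y t -> E y x t) ->
  extend E n p q t -> extend E n q p t.
Proof.
move=> Es; have [[c [i [j [Ep Eq]]]]|N] := pselect (exists c, same_cell n p q c).
  by rewrite (extend_same _ _ Ep Eq) (extend_same _ _ Eq Ep); exact: gap_sym.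
rewrite !extend_far //; first by move=> [? /Es ? ?].
by move=> [c [i [j [Ep Eq]]]]; apply: N; exists c, j, i.
Qed.

(** The cases are whether [p], [q] and [q], [r] share a cell; [mixed] treats entering or leaving a
    path, and symmetry gives the reverse direction. *)
Lemma extend_trans E n p q r t :
  (forall x, E x x t) -> (forall x y, E x y t -> E y x t) ->
  (forall x y z, E x y t -> E y z t -> E x z t) ->
  extend E n p q t -> extend E n q r t -> extend E n p r t.
Proof.
move=> Er Es Et.
have sym p' q' : (exists c, same_cell n p' q' c) -> exists c, same_cell n q' p' c.
  by move=> [c [i [j [? ?]]]]; exists c, j, i.
have mixed p' q' r' : (exists c, same_cell n p' q' c) ->
    ~ (exists c, same_cell n q' r' c) ->
    extend E n p' q' t -> extend E n q' r' t -> extend E n p' r' t.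
  move=> [c [i [j [Ep Eq]]]] Nqr; rewrite (extend_same _ _ Ep Eq) => g.
  have Npr : ~ (exists c, same_cell n p' r' c).
    move=> [d [i' [k [Ep' Ek]]]]; apply: Nqr; move: Ep'; rewrite Ep => -[_ cd].
    by exists d, j, k; rewrite Eq cd.
  rewrite (extend_far _ _ Nqr) (extend_far _ _ Npr).
  move=> [cq Eqr cr]; have [cp Epq] := same_cell_gap Er Es Ep Eq g cq.
  by split=> //; exact: Et Epq Eqr.
have [Spq|Npq] := pselect (exists c, same_cell n p q c);
  have [Sqr|Nqr] := pselect (exists c, same_cell n q r c).
- move: Spq Sqr => [c [i [j [Ep Eq]]]] [d [j' [k [Eq' Ek]]]].
  move: Eq'; rewrite Eq => -[_ cd]; subst d.
  rewrite (extend_same _ _ Ep Eq) (extend_same _ _ Eq Ek) (extend_same _ _ Ep Ek).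
  by case: i {Ep}; case: j {Eq}; case: k {Ek} => //=; tauto.
- exact: mixed.
- move=> pq qr; apply: extend_sym => //.
  apply: (mixed r q p) => //; [exact: sym|by move/sym|exact: extend_sym|exact: extend_sym].
- rewrite (extend_far _ _ Npq) (extend_far _ _ Nqr) => -[cp Epq _] [_ Eqr cr].
  have [[c [i [j [Ep Eq]]]]|N] := pselect (exists c, same_cell n p r c).
    by rewrite (extend_same _ _ Ep Eq); exact: same_cell_cost cp cr.
  by rewrite (extend_far _ _ N); split=> //; exact: Et Epq Eqr.
Qed.

Lemma close_equivalence n t :
  equivalence point (fun p q => close n p q t).
Proof.
elim: n => [|n [Er Et Es]]; first by split.
split=> [p|p q r|p q]; first exact: extend_refl.
  exact: extend_trans.
exact: extend_sym.
Qed.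

Lemma cell_old n p : depth p <= n -> cell n p = None.
Proof. by rewrite /cell; case: p => // i x y a b ->. Qed.

(** Old points have no cell, cost nothing and are their own anchors. *)
Lemma close_succ n p q t : depth p <= n -> depth q <= n ->
  close n.+1 p q t <-> close n p q t.
Proof.
move=> pn qn; rewrite /= /extend /far /cost /anchor !cell_old //.
by split=> [[]|].
Qed.

Lemma dist_leE n p q t : depth p <= n -> depth q <= n ->
  dist_le p q t <-> close n p q t.
Proof.
move=> pn qn; have : maxn (depth p) (depth q) <= n by rewrite geq_max pn.
elim: n {pn qn} => [|n IH]; first by rewrite leqn0 /dist_le => /eqP->.
rewrite leq_eqVlt => /orP[/eqP E|]; first by rewrite /dist_le E.
rewrite ltnS => H; rewrite close_succ ?IH //.
  exact: leq_trans (leq_maxl _ _) H.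
exact: leq_trans (leq_maxr _ _) H.
Qed.

Lemma dist_le_equivalence t :
  equivalence point (fun p q => dist_le p q t).
Proof.
split=> [p|p q r|p q].
- by have [Er _ _] := close_equivalence (maxn (depth p) (depth p)) t; apply: Er.
- pose n := maxn (depth p) (maxn (depth q) (depth r)).
  have [_ Et _] := close_equivalence n t.
  have pn : depth p <= n by exact: leq_maxl.
  have qn : depth q <= n by rewrite /n leq_max leq_maxl orbT.
  have rn : depth r <= n by rewrite /n leq_max leq_maxr orbT.
  by rewrite !(@dist_leE n) //; exact: Et.
- have [_ _ Es] := close_equivalence (maxn (depth p) (depth q)) t.
  by rewrite /dist_le [maxn (depth q) _]maxnC; exact: Es.
Qed.

Lemma cell_new i x y a b :
  cell (maxn (depth x) (depth y)) (node i x y a b) = Some (i, (x, y, a, b)).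
Proof. by rewrite /cell /= ltnn. Qed.

(** The hypothesis says that the distance of [x] and [y] is at most the join of [a] and [b]; it
    attaches the third point to [y], so the last link has length [b]. *)
Lemma node_path x y a b t : (forall u, le a u -> le b u -> dist_le x y u) ->
  [/\ le a t -> dist_le x (node P1 x y a b) t,
      le b t -> dist_le (node P1 x y a b) (node P2 x y a b) t,
      le a t -> dist_le (node P2 x y a b) (node P3 x y a b) t
    & le b t -> dist_le (node P3 x y a b) y t].
Proof.
move=> H; pose n := maxn (depth x) (depth y).
have xn : depth x <= n by exact: leq_maxl.
have yn : depth y <= n by exact: leq_maxr.
have [Er _ _] := close_equivalence n t.
split=> lt; apply/(@dist_leE n.+1) => //; try exact: leqW.
- by rewrite /= /extend /far /cost /anchor cell_new cell_old.
- by rewrite /= (extend_same _ _ (cell_new _ _ _ _ _) (cell_new _ _ _ _ _)).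
- by rewrite /= (extend_same _ _ (cell_new _ _ _ _ _) (cell_new _ _ _ _ _)).
- rewrite /= /extend /far /cost /anchor cell_new cell_old //=.
  by rewrite asboolT.
Qed.

(** Realizes each label as a distance, as injectivity of the embedding requires. *)
Lemma dist_origin a b t : dist_le origin (node P1 origin origin a b) t <-> le a t.
Proof.
by rewrite /dist_le /= /extend /far /cost /=; split=> [[]|].
Qed.

(** Varying [b'] yields points pairwise at distance at least [a], which bounds the number of points
    from below. *)
Lemma dist_distinct_cells a b b' t :
  dist_le (node P1 origin origin a b) (node P1 origin origin a b') t ->
  b = b' \/ le a t.
Proof.
rewrite /dist_le /= /extend /=; case: asboolP => [[->]|_ []]; first by left.
by rewrite /cost /= => ? _ _; right.
Qed.

Variables (bot : K) (join : K -> K -> K).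
Hypothesis le_bot : forall t, le bot t.
Hypothesis le_join : forall a b t, le (join a b) t <-> le a t /\ le b t.

(** Distances are assembled from labels by finitely many joins, with [bot] for zero, so each is an
    element of [K] and not merely a filter. *)
Lemma close_attained n p q : exists k, forall t, close n p q t <-> le k t.
Proof.
elim: n p q => [|n IH] p q; first by exists bot => t; split.
have cost_att r : exists k, forall t, cost n r t <-> le k t.
  rewrite /cost; case: (cell n r) => [[[] [[[x y] a] b]]|]; last by exists bot.
  - by exists a.
  - by exists (join a b) => t; rewrite le_join.
  - by exists b.
have far_att : exists k, forall t, far (close n) n p q t <-> le k t.
  have [k1 H1] := cost_att p; have [k2 H2] := cost_att q.
  have [k3 H3] := IH (anchor (close n) n p) (anchor (close n) n q).
  exists (join k1 (join k2 k3)) => t; rewrite !le_join -H1 -H2 -H3 /far.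
  by split=> [[]|[? []]].
rewrite /= /extend; case: (cell n p) => [[i c]|] //; case: (cell n q) => [[j d]|] //.
case: asboolP => // _; case: i; case: j => /=; try by exists bot.
all: try by eexists => t; split; eauto.
all: by exists (join c.1.2 c.2) => t; rewrite le_join.
Qed.

Lemma dist_attained p q : exists k, forall t, dist_le p q t <-> le k t.
Proof. exact: close_attained. Qed.

End Points.

(** * The embedding *)

Lemma point_injection (O K : Type) (pair : O * O -> O) (tag : nat -> O)
    (enc : K -> O) : injective pair -> injective tag -> injective enc ->
  exists f : point K -> O, injective f.
Proof.
move=> pairI tagI encI.
pose pos i := match i with P1 => 1 | P2 => 2 | P3 => 3 end.
pose f := fix f p := match p with
  | origin => pair (tag 0, tag 0)
  | node i x y a b =>
      pair (tag (pos i), pair (pair (f x, f y), pair (enc a, enc b)))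
  end.
exists f; elim=> [|i x IHx y IHy a b] [|i' x' y' a' b'] //= /pairI[] /tagI.
- by case: i'.
- by case: i.
move=> ii /pairI[/pairI[/IHx-> /IHy->]] /pairI[/encI-> /encI->].
by case: i i' ii => [] [].
Qed.

Lemma lterm_injection (O X : Type) (pair : O * O -> O) (tag : nat -> O)
    (enc : X -> O) : injective pair -> injective tag -> injective enc ->
  exists f : lterm X -> O, injective f.
Proof.
move=> pairI tagI encI.
pose f := fix f (k : lterm X) := match k with
  | LVar x => pair (tag 0, enc x)
  | LMeet k1 k2 => pair (tag 1, pair (f k1, f k2))
  | LJoin k1 k2 => pair (tag 2, pair (f k1, f k2))
  end.
exists f; elim=> [x|k1 IH1 k2 IH2|k1 IH1 k2 IH2] [x'|k1' k2'|k1' k2'] //=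
  /pairI[]; try by move=> /tagI.
- by move=> /encI->.
- by move=> /pairI[/IH1-> /IH2->].
- by move=> /pairI[/IH1-> /IH2->].
Qed.

Lemma transversal (X : Type) (R : X -> X -> Prop) : equivalence X R ->
  exists r : X -> X, (forall x, R x (r x)) /\ (forall x y, R x y -> r x = r y).
Proof.
move=> [Rr Rt Rs].
(* Choice is made on subsets, so that related elements, having equal classes, receive the same
   representative; [None] is the default for the empty subset. *)
have /choice[c cP] (A : set X) : exists x : option X, (exists y, A y) ->
    if x is Some z then A z else False.
  have [[y Ay]|N] := pselect (exists y, A y); first by exists (Some y).
  by exists None.
have /choice[r rP] (x : X) : exists y, c (R x) = Some y.
  have := cP (R x) (ex_intro _ x (Rr x)).
  by case: (c (R x)) => // y; exists y.
exists r; split=> [x|x y Rxy].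
  by have := cP (R x) (ex_intro _ x (Rr x)); rewrite rP.
have E : R x = R y.
  apply/predeqP => z; split=> H; last exact: Rt Rxy H.
  exact: Rt (Rs _ _ Rxy) H.
by have := rP x; rewrite E rP => -[].
Qed.

(** Cantor-Bernstein between [O] and the set [A] of chosen representatives: [f] injects [A] into
    [O], and [g] followed by [r] injects [O] into [A]. *)
Lemma quotient_enumeration (X O : Type) (R : X -> X -> Prop) (f : X -> O)
    (g : O -> X) : equivalence X R -> injective f ->
  (forall o o', R (g o) (g o') -> o = o') ->
  exists h : O -> X, (forall x, exists o, R x (h o)) /\
    (forall o o', R (h o) (h o') -> o = o').
Proof.
move=> Req fI gI; have [r [Rr rE]] := transversal Req; case: Req => R1 R2 R3.
pose A : set X := fun x => r x = x.
have Ar (x : X) : A (r x) by apply: rE; apply: R3; exact: Rr.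
pose B : set O := fun=> True.
have le1 : (A #<= B)%card.
  have /injfunPex[F] : exists2 F : X -> O, set_fun A B F & set_inj A F.
    by exists f => // x y _ _; exact: fI.
  exact: inj_card_le F.
have le2 : (B #<= A)%card.
  have /injfunPex[F] : exists2 F : O -> X, set_fun B A F & set_inj B F.
    exists (r \o g) => [o _|o o' _ _ /= E]; first exact: Ar.
    by apply: gI; apply: R2 (Rr _) _; rewrite E; apply: R3; exact: Rr.
  exact: inj_card_le F.
have /card_bijP[h [h' hK h'K]] := Cantor_Bernstein le2 le1.
have inA (x : A) : r (val x) = val x by have := valP x; rewrite inE.
exists (fun o => val (h (SigSub (mem_set (I : B o))))); split.
- move=> x; pose a : A := SigSub (mem_set (Ar x)).
  exists (val (h' a)); rewrite (_ : SigSub _ = h' a); last exact: val_inj.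
  by rewrite h'K; exact: Rr.
- move=> o o' /rE; rewrite !inA => /val_inj /(can_inj hK) E.
  by have := congr1 val E.
Qed.

(* Every lattice homomorphism (Eq O) ⨿ (Eq O) -> Eq O is the copairing of two
   lattice homomorphisms g1, g2 : Eq O -> Eq O; it is well defined and
   injective iff fp_eval g1 g2 identifies exactly the fp_equiv-classes. *)
Theorem theorem6p4 (O : Type) (Hinf : infinite_type O) :
  exists g1 g2 : EqRel O -> EqRel O,
    eq_lattice_hom g1 /\ eq_lattice_hom g2 /\
    (forall t s : lterm (fpgen O),
        same_eq (fp_eval g1 g2 t) (fp_eval g1 g2 s) <-> fp_equiv t s) /\
    same_eq (fp_eval g1 g2 (fp_top O)) (eq_top O) /\
    same_eq (fp_eval g1 g2 (fp_bot O)) (eq_bot O).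
Proof.
have [o _] := Hinf nil.
pose K := lterm (bool * (O * O)); pose le (k : K) t := wle (emb k) t.
pose D := dist_le le.
have D_equiv t := dist_le_equivalence le t : equivalence _ (fun p q => D p q t).
have D_att p q : exists k, forall t, D p q t <-> le k t.
  apply: (@dist_attained _ _ le (kbot o) (@LJoin _)) => [t|a b t]; first exact: kbot_le.
  split=> [ab|[at_ bt]]; last exact: wle_joinl.
  by split; apply: wle_trans ab; [apply: wle_joinr1|apply: wle_joinr2]; exact: wle_refl.
have D_le p q t s : wle t s -> D p q t -> D p q s.
  by have [k H] := D_att p q; move=> ts /H kt; apply/H; exact: wle_trans ts.
have bot_le t : wle (fp_bot O) t.
  elim: t => [[R|R]|t1 W1 t2 W2|t1 W1 t2 W2].
  - by apply: wle_meetl1; apply: (@wle_var _ true) => x y ->; exact: rel_refl.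
  - by apply: wle_meetl2; apply: (@wle_var _ false) => x y ->; exact: rel_refl.
  - exact: wle_meetr.
  - exact: wle_joinr1.
have top_le t : wle t (fp_top O).
  elim: t => [[R|R]|t1 W1 t2 W2|t1 W1 t2 W2].
  - by apply: wle_joinr1; apply: (@wle_var _ true).
  - by apply: wle_joinr2; apply: (@wle_var _ false).
  - exact: wle_meetl1.
  - exact: wle_joinl.
have [pair pairI] := infinite_square_injection Hinf.
have [tag tagI] := infinite_nat_injection Hinf.
have [encK encKI] : exists f : K -> O, injective f.
  apply: (lterm_injection (enc := fun z : bool * (O * O) =>
    pair (tag z.1, pair z.2)) pairI tagI).
  by move=> [b z] [b' z'] /pairI[/tagI + /pairI->]; case: b; case: b'.
have [enc encI] := point_injection pairI tagI encKI.
pose loop : K := LVar (true, (o, o)).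
pose pt o' : point K := node P1 (origin K) (origin K) loop (LVar (true, (o, o'))).
(* Distinct second labels put the points at distance at least [loop]; this is above the least
   element, since no member of the first factor lies below a member of the second. *)
have ptI x y : D (pt x) (pt y) (fp_bot O) -> x = y.
  move=> H'; case: (dist_distinct_cells H') => [[]|H] //; exfalso.
  have : wle (emb loop) (LVar (inr (eq_bot O))).
    by apply: wle_trans H _; apply: wle_meetl2; exact: wle_refl.
  by move=> W; have [] := wle_covers false W.
have [f [f_onto f_inj]] := quotient_enumeration (D_equiv (fp_bot O)) encI ptI.
have rep p t x : D p (f x) (fp_bot O) -> D p (f x) t by exact: D_le.
pose Phi t : EqRel O := exist _ (fun x y => D (f x) (f y) t)
  (let: Build_equivalence r tr s := D_equiv t in
   Build_equivalence _ _ (fun x => r (f x)) (fun x y z => tr (f x) (f y) (f z))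
     (fun x y => s (f x) (f y))).
(* By density, compact elements suffice, and each of them is the distance of [origin] from some
   node. *)
have Phi_le t s : wle t s <-> eq_le (Phi t) (Phi s).
  split=> [ts x y|H]; first exact: D_le.
  apply: (wle_density o) => k kt.
  have [x Hx] := f_onto (origin K).
  have [y Hy] := f_onto (node P1 (origin K) (origin K) k k).
  have Dk u : D (f x) (f y) u <-> le k u.
    rewrite -(dist_origin le k k u); have [_ tr sy] := D_equiv u.
    split=> H'.
      exact: tr (rep _ _ _ Hx) (tr _ _ _ H' (sy _ _ (rep _ _ _ Hy))).
    exact: tr (sy _ _ (rep _ _ _ Hx)) (tr _ _ _ H' (rep _ _ _ Hy)).
  by apply/Dk; apply: H; apply/Dk.
have Phi_meet t s : same_eq (Phi (LMeet t s)) (eq_meet (Phi t) (Phi s)).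
  move=> x y; have [k H] := D_att (f x) (f y); split=> [xy|[/H kt /H ks]].
    by split; apply: D_le xy; [apply: wle_meetl1|apply: wle_meetl2]; exact: wle_refl.
  by apply/H; exact: wle_meetr.
have Phi_join t s : same_eq (Phi (LJoin t s)) (eq_join (Phi t) (Phi s)).
  move=> x y; split; last first.
    apply: eq_join_le; apply/Phi_le; [apply: wle_joinr1|apply: wle_joinr2];
      exact: wle_refl.
  have [k H] := D_att (f x) (f y).
  (* The distance [k] is compact, so it splits into [a] below [t] and [b] below [s]; the inserted
     path then alternates between [Phi t] and [Phi s]. *)
  move=> /H/(wle_join_compact o)[a [b [at_ bs kab]]].
  have xy u : le a u -> le b u -> D (f x) (f y) u.
    by move=> au bu; apply/H; apply: wle_trans kab _; exact: wle_joinl.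
  have [/(_ at_) D1 _ /(_ at_) D3 _] := node_path t xy.
  have [_ /(_ bs) D2 _ /(_ bs) D4] := node_path s xy.
  have move_to p q x' y' u : D p (f x') (fp_bot O) -> D q (f y') (fp_bot O) ->
      D p q u -> rel_of (Phi u) x' y'.
    move=> px qy pq; have [_ tr sy] := D_equiv u.
    exact: tr (sy _ _ (rep _ _ _ px)) (tr _ _ _ pq (rep _ _ _ qy)).
  have [Dr _ _] := D_equiv (fp_bot O).
  (* The inner points are replaced by their enumerated representatives, at least distance from
     them. *)
  have [z1 Z1] := f_onto (node P1 (f x) (f y) a b).
  have [z2 Z2] := f_onto (node P2 (f x) (f y) a b).
  have [z3 Z3] := f_onto (node P3 (f x) (f y) a b).
  apply: (t_trans _ _ _ z1); first by apply: t_step; left; exact: move_to Z1 D1.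
  apply: (t_trans _ _ _ z2); first by apply: t_step; right; exact: move_to Z1 Z2 D2.
  apply: (t_trans _ _ _ z3); first by apply: t_step; left; exact: move_to Z2 Z3 D3.
  by apply: t_step; right; exact: move_to Z3 (Dr _) D4.
pose g b R := Phi (var b R).
have same_le R S : eq_le R S -> eq_le S R -> same_eq R S.
  by move=> RS SR x y; split; [exact: RS|exact: SR].
have le_same R S : same_eq R S -> eq_le R S /\ eq_le S R.
  by move=> RS; split=> x y /RS.
have Phi_equiv t s : fp_equiv t s <-> same_eq (Phi t) (Phi s).
  split=> [/fp_equivP[/Phi_le ts /Phi_le st]|/le_same[/Phi_le ts /Phi_le st]].
    exact: same_le.
  by apply/fp_equivP.
have g_hom b : eq_lattice_hom (g b).
  split=> [R S /le_same[RS SR]|].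
    by apply: same_le; apply/Phi_le; exact: wle_var.
  split=> R S x y; [rewrite -Phi_meet|rewrite -Phi_join]; move: x y;
    apply/Phi_equiv; [exact: fp_var_meet|exact: fp_var_join].
have eval t : same_eq (fp_eval (g true) (g false) t) (Phi t).
  elim: t => [[R|R]|t1 H1 t2 H2|t1 H1 t2 H2] x y //.
    by rewrite Phi_meet /= H1 H2.
  rewrite Phi_join; have [A1 B1] := le_same _ _ _ H1; have [A2 B2] := le_same _ _ _ H2.
  apply: (same_le _ (eq_join _ _)) => {x y}; apply: eq_join_le => x y H.
  - by apply: eq_le_joinl; exact: A1.
  - by apply: eq_le_joinr; exact: A2.
  - by apply: eq_le_joinl; exact: B1.
  - by apply: eq_le_joinr; exact: B2.
exists (g true), (g false); split=> //; split=> //; split; last split.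
- move=> t s; rewrite Phi_equiv; split=> H x y.
    by rewrite -!eval.
  by rewrite !eval.
- move=> x y; rewrite eval; split=> // _.
  by have [k H] := D_att (f x) (f y); apply/H; exact: top_le.
(* Points at least distance were identified, so [Phi] sends the least element to equality. *)
- move=> x y; rewrite eval; split=> [/f_inj //|/= <-].
  by have [Dr _ _] := D_equiv (fp_bot O); exact: Dr.
Qed.
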